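(* There is an absolute constant $C>0$ and an explicit (deterministically constructed, without use of the probabilistic method) family of worker-task assignment functions $\phi_{w,t}$, one for each pair of integers $w,t\ge 2$, such that $\phi_{w,t}$ assigns $w$ workers to task multisets over $[t]$ and has switching cost at most $C(\log(wt))^{C}$, i.e. switching cost $\operatorname{polylog}(wt)$.
   Context: Let $w,t$ be positive integers. A task multiset is a multiset $T$ of size $|T|=w$ whose elements lie in $[t]=\{1,\dots,t\}$; write $m_T(j)$ for the multiplicity of $j$ in $T$. A worker-task assignment function $\phi$ assigns to every task multiset $T$ a map $\phi(T):[w]\to[t]$ such that for each task $j$ exactly $m_T(j)$ workers are mapped to $j$. Two task multisets $T_1,T_2$ of size $w$ are adjacent if $|T_1\setminus T_2|=|T_2\setminus T_1|=1$ (multiset difference). The switching cost between adjacent $T_1,T_2$ is the number of workers $i$ with $\phi(T_1)(i)\ne\phi(T_2)(i)$; the switching cost of $\phi$ is the maximum over all adjacent pairs. *)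

(* Defs.v *)
(* MathComp world: finmap multisets, MathComp-Analysis reals. *)
From HB Require Import structures.
From mathcomp Require Import all_boot all_order all_algebra.
From mathcomp Require Import finmap multiset.
From mathcomp Require Import reals exp.

Set Implicit Arguments.
Unset Strict Implicit.
Unset Printing Implicit Defensive.

Local Open Scope nat_scope.

(* The tasks 1, ..., t and the workers 1, ..., w are numbered from 0. *)
Record task_multiset (w t : nat) := TaskMultiset {
  tasks :> {mset 'I_t}%mset;
  tasks_size : size tasks == w
}.

HB.instance Definition _ w t := [isSub for @tasks w t].
HB.instance Definition _ w t := [Choice of task_multiset w t by <:].

(* A multiset of size w is determined by a w-tuple listing it, which makes
   task_multiset w t a finite type. *)
Definition tuple_of_tasks w t (T : task_multiset w t) : w.-tuple 'I_t :=
  Tuple (tasks_size T).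

Definition tasks_of_tuple w t (s : w.-tuple 'I_t) :
    option (task_multiset w t) :=
  insub (seq_mset s).

Lemma tuple_of_tasksK w t :
  pcancel (@tuple_of_tasks w t) (@tasks_of_tuple w t).
Proof.
move=> T; rewrite /tasks_of_tuple /=.
have -> : seq_mset (tasks T) = tasks T.
  apply/msetP => j.
  by rewrite -count_mem_mset (permP (perm_eq_seq_mset _)) count_mem_mset.
exact: valK.
Qed.

HB.instance Definition _ w t := PCanIsCountable (@tuple_of_tasksK w t).
HB.instance Definition _ w t : isFinite (task_multiset w t) :=
  PCanIsFinite (@tuple_of_tasksK w t).

Record assignment (w t : nat) := Assignment {
  assign :> task_multiset w t -> 'I_w -> 'I_t;
  assign_card : forall (T : task_multiset w t) (j : 'I_t),
    #|[set i | assign T i == j]| = tasks T j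
}.

Definition adjacent (w t : nat) (T1 T2 : task_multiset w t) : bool :=
  (size (T1 `\` T2)%mset == 1) && (size (T2 `\` T1)%mset == 1).

Definition pair_switching_cost (w t : nat) (phi : assignment w t)
    (T1 T2 : task_multiset w t) : nat :=
  #|[set i | phi T1 i != phi T2 i]|.

Definition switching_cost (w t : nat) (phi : assignment w t) : nat :=
  \max_(T1 : task_multiset w t) \max_(T2 : task_multiset w t | adjacent T1 T2)
    pair_switching_cost phi T1 T2.

(* "Explicit" is read as usual in derandomization: one deterministic algorithm,
   uniform in w and t, evaluates the function in polynomial time.  The machine
   is a unit-cost random access machine with addition and truncated subtraction
   (no multiplication), presented by structured programs; it is polynomially
   equivalent to Turing machines.  Registers are named by fixed numbers, while
   memory cells are addressed through the contents of registers. *)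
Inductive prog : Type :=
| IConst (x c : nat)              (* x := c *)
| IAdd (x y z : nat)              (* x := y + z *)
| ISub (x y z : nat)              (* x := y - z *)
| IRead (x y : nat)               (* x := cell[y] *)
| IWrite (x y : nat)              (* cell[x] := y *)
| ISeq (p q : prog)
| IIf (x : nat) (p q : prog)      (* branches on x <> 0 *)
| IWhile (x : nat) (p : prog).    (* loops as long as x <> 0 *)

Record state := State { reg : nat -> nat; cell : nat -> nat }.

Definition upd (f : nat -> nat) (a v : nat) : nat -> nat :=
  fun b => if b == a then v else f b.

Definition set_reg (s : state) (x v : nat) : state :=
  State (upd (reg s) x v) (cell s).

Definition set_mem (s : state) (a v : nat) : state :=
  State (reg s) (upd (cell s) a v).

(* [exec p s n s']: from s, the program p halts in state s' after n steps. *)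
Inductive exec : prog -> state -> nat -> state -> Prop :=
| exec_const x c s : exec (IConst x c) s 1 (set_reg s x c)
| exec_add x y z s : exec (IAdd x y z) s 1 (set_reg s x (reg s y + reg s z))
| exec_sub x y z s : exec (ISub x y z) s 1 (set_reg s x (reg s y - reg s z))
| exec_read x y s : exec (IRead x y) s 1 (set_reg s x (cell s (reg s y)))
| exec_write x y s : exec (IWrite x y) s 1 (set_mem s (reg s x) (reg s y))
| exec_seq p q s s1 s2 m n :
    exec p s m s1 -> exec q s1 n s2 -> exec (ISeq p q) s (m + n) s2
| exec_if_true x p q s s1 n :
    reg s x != 0 -> exec p s n s1 -> exec (IIf x p q) s n.+1 s1
| exec_if_false x p q s s1 n :
    reg s x = 0 -> exec q s n s1 -> exec (IIf x p q) s n.+1 s1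
| exec_while_true x p s s1 s2 m n :
    reg s x != 0 -> exec p s m s1 -> exec (IWhile x p) s1 n s2 ->
    exec (IWhile x p) s (m + n).+1 s2
| exec_while_false x p s :
    reg s x = 0 -> exec (IWhile x p) s 1 s.

(* Initially registers 0 and 1 hold w and t, memory cell j < t holds the
   multiplicity of task j, and everything else is 0. *)
Definition input_state (w t : nat) (T : task_multiset w t) : state :=
  State (upd (upd (fun=> 0) 0 w) 1 t)
        (fun a => if insub a is Some j then tasks T j else 0).

(* On halting, memory cell i < w holds the task assigned to worker i.  Since
   w + t >= 4, a bound (w + t) ^ d covers every polynomial in w and t.  The
   program and the exponent do not depend on w, t and the task multiset. *)
Definition explicit_family (phi : forall w t : nat, assignment w t) : Prop :=
  exists (p : prog) (d : nat),
    forall (w t : nat), 2 <= w -> 2 <= t -> forall T : task_multiset w t,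
      exists (n : nat) (s : state),
        [/\ exec p (input_state T) n s,
            n <= (w + t) ^ d
          & forall i : 'I_w, cell s i = phi w t T i].

(* Main.v *)
Require Import Defs.
From mathcomp Require Import all_boot all_order all_algebra.
From mathcomp Require Import finmap multiset.
From mathcomp Require Import zify lra.
From mathcomp Require sequences.
From mathcomp Require Import reals exp.

(* The tasks are the leaves of a binary tree of depth about log t: at depth i,
   task j lies below the node j mod 2^i. A node holding n workers, numbered
   0, ..., n - 1, passes a of them to one child and b = n - a to the other,
   where a and b count the tasks below the children, and numbers them afresh.
   When a task is inserted, one of a, b grows by one at every node of a single
   branch and nothing changes elsewhere, so it is enough to find bijections
   f_(a,b) : [0, a+b) -> [0, a) + [0, b) that change in O(log n) places when a
   or b grows by one; the costs along the branch add up.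

   Let f_(a,b) keep p < a on the first side, and let it send a <= p < b to p on
   the second side. The remaining p in [max a b, a+b) must be matched with the
   numbers in [0, min a b). This is done greedily, for e from large to small,
   by matching numbers that are still free and congruent mod 2^e. In a residue
   class mod 2^e the two sides differ in number by
     #[0, a) + #[0, b) - #[0, a+b)  in  {-1, 0, 1},
   so that after round e a class contains at most one free number, and round 0
   matches everything. When a grows, round e can only change the one pair that it
   forms in the class of a and the one in the class of a+b; rounds with 2^e > n
   change nothing, since there congruent numbers are equal. *)

Set Implicit Arguments.
Unset Strict Implicit.
Unset Printing Implicit Defensive.

Local Open Scope nat_scope.

(** * Residues modulo powers of two *)
Definition eqm (e x y : nat) : bool := x %% 2 ^ e == y %% 2 ^ e.

Lemma eqm_refl e x : eqm e x x. Proof. exact: eqxx. Qed.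

Lemma eqm_sym e x y : eqm e x y = eqm e y x.
Proof. exact: eq_sym. Qed.

Lemma eqm_trans e y x z : eqm e x y -> eqm e y z -> eqm e x z.
Proof. by rewrite /eqm => /eqP-> /eqP->. Qed.

Lemma eqm_eql e x y z : eqm e x y -> eqm e z x = eqm e z y.
Proof. by rewrite /eqm => /eqP->. Qed.

Lemma eqm_le e e' x y : e <= e' -> eqm e' x y -> eqm e x y.
Proof.
move=> le_e; rewrite /eqm => /eqP eq_xy.
have dv : 2 ^ e %| 2 ^ e' by exact: dvdn_exp2l.
by rewrite -(modn_dvdm x dv) eq_xy (modn_dvdm y dv).
Qed.

Lemma eqm_small e x y : x < 2 ^ e -> y < 2 ^ e -> eqm e x y = (x == y).
Proof. by move=> hx hy; rewrite /eqm !modn_small. Qed.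

(** [odd (x %/ 2 ^ e)] is the binary digit of [x] in position [e], the only one in which remainders
    mod 2^e and mod 2^(e+1) differ. *)
Lemma eqmS e x y :
  eqm e.+1 x y = eqm e x y && (odd (x %/ 2 ^ e) == odd (y %/ 2 ^ e)).
Proof.
have m0 : 0 < 2 ^ e by rewrite expn_gt0.
have E z : z %% 2 ^ e.+1 = odd (z %/ 2 ^ e) * 2 ^ e + z %% 2 ^ e.
  by rewrite expnS -modn2 modn_divl {1}(divn_eq (z %% (2 * 2 ^ e)) (2 ^ e)) modn_dvdm // dvdn_mull.
rewrite /eqm !E; apply/eqP/andP => [h|[/eqP-> /eqP->]] //.
have := congr1 (modn^~ (2 ^ e)) h; have := congr1 (divn^~ (2 ^ e)) h.
rewrite !divnMDl // !modnMDl !modn_mod !(divn_small (ltn_pmod _ m0)) !addn0.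
by move=> /eqP h1 /eqP h2; split=> //; move: h1; do 2 case: odd.
Qed.

Lemma eqm_addr e x : eqm e (x + 2 ^ e) x.
Proof. by rewrite /eqm modnDr. Qed.

(** A class mod 2^e is the disjoint union of two classes mod 2^(e+1), its halves. The booleans are
    read as numbers so that the identity can be summed. *)
Lemma eqm_split e y c :
  eqm e y c = eqm e.+1 y c + eqm e.+1 y (c + 2 ^ e) :> nat.
Proof.
rewrite !eqmS divnDr ?dvdnn // divnn expn_gt0 /= oddD (eqm_eql _ (eqm_addr e c)).
by case: (eqm e y c) => //=; do 2 case: odd.
Qed.

Lemma eqm_sib e x y : eqm e x y -> ~~ eqm e.+1 x y -> eqm e.+1 x (y + 2 ^ e).
Proof. by move=> h1 /negbTE h2; have := eqm_split e x y; rewrite h1 h2; case: eqm. Qed.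

Definition cnt (e c x : nat) : nat := \sum_(y < x) eqm e y c.

Lemma cntS e c x : cnt e c x.+1 = cnt e c x + eqm e x c.
Proof. by rewrite /cnt big_ord_recr. Qed.

Lemma cnt_split e c x :
  cnt e c x = cnt e.+1 c x + cnt e.+1 (c + 2 ^ e) x.
Proof. by rewrite /cnt -big_split; apply: eq_bigr => y _; exact: eqm_split. Qed.

Lemma cnt_eqm e c c' x : eqm e c c' -> cnt e c x = cnt e c' x.
Proof. by move=> h; apply: eq_bigr => y _; rewrite (eqm_eql _ h). Qed.

(** When [x] grows by one, the quotient grows exactly if [x] is congruent to [c]. The shift is the
    same for all [x], so an excess becomes a combination of three floors. *)
Lemma cnt_div e c x :
  cnt e c x = (x + (2 ^ e - (c %% 2 ^ e).+1)) %/ 2 ^ e.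
Proof.
have m0 : 0 < 2 ^ e by rewrite expn_gt0.
have lc : c %% 2 ^ e < 2 ^ e by exact: ltn_pmod.
elim: x => [|x IH].
  by rewrite /cnt big_ord0 divn_small // add0n ltn_subrL /= m0.
rewrite cntS IH addSn divnS // addnC; congr (nat_of_bool _ + _).
rewrite -addnS subnSK // /eqm.
rewrite -(eqn_modDr (2 ^ e - c %% 2 ^ e)) /dvdn; congr (_ == _).
by rewrite -modnDml subnKC ?modnn // ltnW.
Qed.

Lemma cnt0 c x : cnt 0 c x = x.
Proof. by rewrite cnt_div expn0 !modn1 addn0 divn1. Qed.

Lemma cnt_top e c x : c < 2 ^ e -> x <= 2 ^ e -> cnt e c x = (c < x).
Proof.
move=> hc; elim: x => [|x IH] hx; first by rewrite /cnt big_ord0.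
by rewrite cntS IH ?(ltnW hx) // eqm_small // ltnS; case: ltngtP.
Qed.

(** * Greedy matching by residues modulo powers of two *)

Section Matching.
Variables (top a b : nat).

(* By how much the numbers of [0, a) and [0, b) that are congruent to c mod 2^e
   outnumber those of [0, a+b); equivalently, those of [0, min a b) outnumber
   those of [max a b, a+b). *)
Definition excess (e c : nat) : int :=
  ((cnt e c a + cnt e c b)%:Z - (cnt e c (a + b))%:Z)%R.

Lemma excess0 c : excess 0 c = 0%R.
Proof. by rewrite /excess !cnt0; lia. Qed.

Lemma excess_split e c :
  excess e c = (excess e.+1 c + excess e.+1 (c + 2 ^ e))%R.
Proof. by rewrite /excess !(cnt_split e c); lia. Qed.

(** With m = 2^e and a shift r < m, the excess is x + y - z for the floors of (a+r)/m, (b+r)/m and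
    (a+b+r)/m. The rounding errors and the additional r keep x + y strictly between z - 2 and z +
    2. *)
Lemma excess_bound e c : (-1 <= excess e c <= 1)%R.
Proof.
rewrite /excess !cnt_div.
have m0 : 0 < 2 ^ e by rewrite expn_gt0.
set m := 2 ^ e in m0 *; set r := m - _.
have hr : r < m by rewrite /r; lia.
have E z : z %/ m * m <= z < (z %/ m).+1 * m by rewrite leq_trunc_div ltn_ceil.
move: (E (a + r)) (E (b + r)) (E (a + b + r)).
move: (_ %/ m) (_ %/ m) (_ %/ m) => z y x.
move=> /andP[x1 x2] /andP[y1 y2] /andP[z1 z2].
clear E; clearbody r; clearbody m.
have h1 : (x + y) * m < (z + 2) * m.
  by rewrite !mulnDl ?mulSn in x1 x2 y1 y2 z1 z2 *; lia.
have h2 : z * m < (x + y + 2) * m.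
  by rewrite !mulnDl ?mulSn in x1 x2 y1 y2 z1 z2 *; lia.
by move: h1 h2; rewrite !ltn_pmul2r // => h1 h2; clear -h1 h2; lia.
Qed.

Lemma excess_eqm e c c' : eqm e c c' -> excess e c = excess e c'.
Proof. by move=> h; rewrite /excess !(cnt_eqm _ h). Qed.

(* For 2^top >= a+b and p < 2^top: p is free after the rounds top, ..., e, where
   s = 1 if p < min a b and s = -1 if max a b <= p < a+b. *)
Definition left_over (s : int) (e p : nat) : bool :=
  all (fun e' => (e <= e') ==> (excess e' p == s)) (iota 0 top.+1).

Lemma left_overP s e p :
  reflect (forall e', e <= e' <= top -> excess e' p = s) (left_over s e p).
Proof.
apply: (iffP allP) => h e'.
  by case/andP=> h1 h2; apply/eqP/(implyP (h e' _)) => //; rewrite mem_iota.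
by rewrite mem_iota /= add0n ltnS => h2; apply/implyP => h1; apply/eqP/h; rewrite h1.
Qed.

(* For s = 1: round e matches p < min a b with q >= max a b; s = -1 exchanges
   the roles of p and q. *)
Definition matched (s : int) (e p q : nat) : bool :=
  [&& e < top, excess e q == 0%R, eqm e p q, left_over s e.+1 p
    & left_over (- s)%R e.+1 q].

Lemma matched_sym s e p q : matched s e p q -> matched (- s)%R e q p.
Proof.
case/and5P=> h1 h2 h3 h4 h5; apply/and5P; split=> //; last by rewrite GRing.opprK.
- by rewrite (excess_eqm h3).
- by rewrite eqm_sym.
Qed.

Lemma left_overW s e e' p : e <= e' -> left_over s e p -> left_over s e' p.
Proof.
move=> le_e /left_overP h; apply/left_overP => e'' /andP[h1 h2].
by apply: h; rewrite (leq_trans le_e h1).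
Qed.

Lemma left_over_exc s e p : e <= top -> left_over s e p -> excess e p = s.
Proof. by move=> le_e /left_overP; apply; rewrite leqnn. Qed.

Lemma left_overS s e p :
  e <= top -> left_over s e p = (excess e p == s) && left_over s e.+1 p.
Proof.
move=> le_e; apply/idP/andP => [h|[/eqP h1 /left_overP h2]].
  by rewrite (left_over_exc le_e h) (left_overW _ h).
apply/left_overP => e' /andP[]; rewrite leq_eqVlt => /orP[/eqP<-//|h3 h4].
by apply: h2; rewrite h3.
Qed.

(** Descending induction on [e], from [top], where congruent numbers are equal. If [p] and [p'] lay
    in different halves of their class, both halves would have excess s and the class 2s, which is
    not s. *)
Lemma left_over_uniq s e p p' :
  s != 0%R -> e <= top -> p < 2 ^ top -> p' < 2 ^ top -> eqm e p p' ->
  left_over s e p -> left_over s e p' -> p = p'.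
Proof.
move=> s0 + hp hp'; elim: {e}(top - e) {-2}e (erefl (top - e)) => [|k IH] e ke le_e.
  have -> : e = top by lia.
  by rewrite eqm_small // => /eqP.
have lt_e : e < top by lia.
move=> pp'; rewrite !(left_overS _ _ le_e) => /andP[/eqP x1 h1] /andP[/eqP x2 h2].
have [|npp'] := boolP (eqm e.+1 p p'); first by move=> ?; apply: (IH e.+1) => //; lia.
have := excess_split e p'.
rewrite -(excess_eqm (eqm_sib pp' npp')) x2.
rewrite (left_over_exc lt_e h1) (left_over_exc lt_e h2).
by move: s0; lia.
Qed.

(** The excesses of the two halves lie in {-1, 0, 1} and add up to s = 1 or s = -1, so one of them
    is s. Following such halves up to level [top] leads to a single number below 2^top. *)
Lemma left_over_ex s e c :
  (s == 1%R) || (s == -1)%R -> e <= top -> excess e c = s ->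
  exists2 p, p < 2 ^ top & eqm e p c && left_over s e p.
Proof.
move=> hs; elim: {e}(top - e) {-2}e (erefl (top - e)) c => [|k IH] e ke c le_e.
  have -> : e = top by lia.
  move=> hc; exists (c %% 2 ^ top); first by rewrite ltn_pmod // expn_gt0.
  have h : eqm top (c %% 2 ^ top) c by rewrite /eqm modn_mod.
  rewrite h left_overS // (excess_eqm h) hc eqxx /=.
  by apply/left_overP => e'; lia.
have lt_e : e < top by lia.
move=> hc; have := excess_split e c; rewrite hc => hc'.
have [c' hc1 hc2] : exists2 c', eqm e c' c & excess e.+1 c' = s.
  have [/eqP h|/eqP h] := boolP (excess e.+1 c == s); first by exists c; rewrite ?eqm_refl.
  exists (c + 2 ^ e); first exact: eqm_addr.
  move: (excess_bound e.+1 c) (excess_bound e.+1 (c + 2 ^ e)) hc' h hs.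
  move: (excess _ _) (excess _ _) => x y; lia.
have [|p hp /andP[h1 h2]] := IH e.+1 _ c' lt_e hc2; first by lia.
have h3 := eqm_trans (eqm_le (leqnSn e) h1) hc1.
by exists p; rewrite // h3 left_overS // h2 (excess_eqm h3) hc eqxx.
Qed.

(** Two left-over numbers in different halves would give their class the excess 2s instead of 0.
    Hence a class of excess 0 forms at most one pair in round [e]. *)
Lemma matched_level_uniq s e p p' :
  s != 0%R -> e < top -> p < 2 ^ top -> p' < 2 ^ top -> eqm e p p' ->
  excess e p = 0%R -> left_over s e.+1 p -> left_over s e.+1 p' -> p = p'.
Proof.
move=> s0 lt_e hp hp' pp' x0 h h'.
have [?|npp'] := boolP (eqm e.+1 p p'); first exact: (left_over_uniq s0 lt_e).
have := excess_split e p'.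
rewrite -(excess_eqm (eqm_sib pp' npp')) -(excess_eqm pp') x0.
by rewrite (left_over_exc lt_e h) (left_over_exc lt_e h'); move: s0; lia.
Qed.

(** The round is determined by [q]: the excess of its class is 0 in the round that matches it, but
    -s in all rounds before. Within one round the partner is unique. *)
Lemma matched_fun s e e' p p' q :
  s != 0%R -> p < 2 ^ top -> p' < 2 ^ top ->
  matched s e p q -> matched s e' p' q -> p = p'.
Proof.
move=> s0 hp hp' /and5P[h1 /eqP h2 h3 h4 h5] /and5P[h1' /eqP h2' h3' h4' h5'].
have ee' : e = e'.
  have [lt|lt|//] := ltngtP e e'.
    by move/left_overP: h5 => /(_ e'); rewrite lt ltnW // h2' => /(_ isT); move: s0; lia.
  by move/left_overP: h5' => /(_ e); rewrite lt ltnW // h2 => /(_ isT); move: s0; lia.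
move: h3' h4'; rewrite -{}ee' => h3' h4' {h1' h2' h5'}.
apply: (matched_level_uniq s0 h1) => //; first by rewrite (eqm_eql _ h3').
by rewrite (excess_eqm h3).
Qed.

(** Let [q] be left over down to round e + 1 but not to round e; this happens because round 0 has
    excess 0. Its half of the class mod 2^e has excess -s and the whole class does not, so the other
    half has excess s and contains a left-over [p]. *)
Lemma matched_ex s q :
  (s == 1%R) || (s == -1)%R -> excess top q = (- s)%R ->
  exists e, exists2 p, p < 2 ^ top & matched s e p q.
Proof.
move=> hs hq.
have : exists e, left_over (- s)%R e q.
  by exists top; rewrite left_overS // hq eqxx; apply/left_overP => e'; lia.
case/ex_minnP => -[|e].
  by move=> /(left_over_exc (leq0n _)); rewrite excess0; move: hs; lia.
move=> h1 h2.
have lt_e : e < top.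
  rewrite ltnNge; apply/negP => le; suff /h2 : left_over (- s)%R e q by rewrite ltnn.
  by apply/left_overP => e' he'; rewrite (_ : e' = top) //; lia.
have e0 : excess e q != (- s)%R.
  apply/eqP => x; suff /h2 : left_over (- s)%R e q by rewrite ltnn.
  by rewrite left_overS ?(ltnW lt_e) // x eqxx.
have hx := left_over_exc lt_e h1.
have hsplit := excess_split e q.
have hsib : excess e.+1 (q + 2 ^ e) = s.
  move: (excess_bound e q) (excess_bound e.+1 (q + 2 ^ e)) hs e0 hsplit.
  rewrite hx; move: (excess _ _) (excess _ _) => x y; lia.
have [p hp /andP[h3 h4]] := left_over_ex hs lt_e hsib.
exists e, p => //; apply/and5P; split=> //.
  by rewrite hsplit hx hsib; lia.
exact: eqm_trans (eqm_le (leqnSn e) h3) (eqm_addr e q).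
Qed.
End Matching.

(** * The bijections at a node and their stability *)

Lemma excess_top top a b c : a + b <= 2 ^ top -> c < 2 ^ top ->
  excess a b top c = (((c < a) + (c < b))%N%:Z - (c < a + b)%N%:Z)%R.
Proof. by move=> hab hc; rewrite /excess !cnt_top //; lia. Qed.

Lemma excessS a b e c :
  excess a.+1 b e c = (excess a b e c + (eqm e a c)%:Z - (eqm e (a + b) c)%:Z)%R.
Proof. by rewrite /excess addSn !cntS; lia. Qed.

Lemma excessC a b e c : excess a b e c = excess b a e c.
Proof. by rewrite /excess (addnC b) addnC. Qed.

(** This allows [n.-1] as the number of the first round, so that no logarithm has to be computed.
    Cost estimates use a sharper bound on the rounds that matter. *)
Lemma leq_exp2_pred n : 0 < n -> n <= 2 ^ n.-1.
Proof. by case: n => // n _; exact: ltn_expl. Qed.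

(* At most one summand is not 0. *)
Definition partner (n a b q : nat) : nat :=
  \sum_(p < n) if has (fun e => matched n.-1 a b 1 e p q) (iota 0 n) then p : nat else 0.

Lemma partnerC n a b q : partner n a b q = partner n b a q.
Proof.
apply: eq_bigr => p _; congr (if _ then _ else _); apply: eq_has => e.
rewrite /matched /left_over excessC; congr [&& _, _, _, _ & _];
by apply: eq_all => e'; rewrite excessC.
Qed.

Lemma partnerE n a b e p q : p < n -> matched n.-1 a b 1 e p q -> partner n a b q = p.
Proof.
move=> hp h; have hn := leq_exp2_pred (leq_ltn_trans (leq0n _) hp).
rewrite /partner (bigD1 (Ordinal hp)) //= big1 ?addn0.
  case: hasP => // -[]; exists e => //; rewrite mem_iota.
  by case/andP: h => h _; lia.
move=> i; case: hasP => // -[e' _ h'] /eqP[]; apply: val_inj => /=.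
by apply: (matched_fun _ _ _ h' h); rewrite ?(leq_trans _ hn).
Qed.

Lemma partner_matched n a b q : a + b <= n -> maxn a b <= q < a + b ->
  (exists e, matched n.-1 a b 1 e (partner n a b q) q) /\ partner n a b q < minn a b.
Proof.
move=> hn hq; have hn0 : 0 < n by lia.
have hn2 := leq_exp2_pred hn0.
have hx : excess a b n.-1 q = (- 1)%R by rewrite excess_top; lia.
have [//|e [p hp h]] := @matched_ex n.-1 a b 1%R q _ hx.
have hpm : p < minn a b.
  case/and5P: (h) => lt_e _ _ h1 _.
  by have := left_over_exc (leqnn _) (left_overW lt_e h1); rewrite excess_top //; lia.
have pn : p < n by lia.
by rewrite (partnerE pn h); split; first by exists e.
Qed.

(** [matched_sym] exchanges the two sides, so uniqueness of the partner also works in this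
    direction. *)
Lemma partner_inj n a b q q' : a + b <= n ->
  maxn a b <= q < a + b -> maxn a b <= q' < a + b ->
  partner n a b q = partner n a b q' -> q = q'.
Proof.
move=> hn hq hq' E; have [[e h] _] := partner_matched hn hq.
have [[e' h'] _] := partner_matched hn hq'.
have hn2 : n <= 2 ^ n.-1 by apply: leq_exp2_pred; lia.
move/matched_sym: h; move/matched_sym: h'; rewrite E => h' h.
by apply: (matched_fun _ _ _ h h') => //; lia.
Qed.

(** Growth of [a] alters the excess only in the classes of [a] and [a + b]. If neither is congruent
    to [q] mod 2^e, neither is congruent mod a higher power to a member of this class, so the whole
    history of the pair is unchanged. *)
Lemma matchedS top a b e p q :
  ~~ eqm e a q -> ~~ eqm e (a + b) q ->
  matched top a b 1 e p q -> matched top a.+1 b 1 e p q.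
Proof.
move=> ha hab /and5P[h1 h2 h3 h4 h5].
have E e' x : e <= e' -> eqm e x q -> excess a.+1 b e' x = excess a b e' x.
  move=> le_e hx; rewrite excessS.
  suff F z : ~~ eqm e z q -> eqm e' z x = false by rewrite !F //; lia.
  by move=> hz; apply: contraNF hz => /(eqm_le le_e) hz; exact: eqm_trans hx.
apply/and5P; split=> //; first by rewrite E ?eqm_refl.
  apply/left_overP => e' /andP[h6 h7]; rewrite E ?(ltnW h6) //.
  by move/left_overP: h4; apply; rewrite h6.
apply/left_overP => e' /andP[h6 h7]; rewrite E ?(ltnW h6) ?eqm_refl //.
by move/left_overP: h5; apply; rewrite h6.
Qed.

(** The exceptions are the numbers matched in the class of [a] or of [a + b], at most one for each
    class and each round e < k. *)
Lemma partner_stable n k a b : a + b < n -> a + b < 2 ^ k ->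
  exists2 s : seq nat, size s <= k * 2 &
    forall q, maxn a.+1 b <= q < a + b ->
      partner n a b q != partner n a.+1 b q -> q \in s.
Proof.
move=> hn hk.
have hn2 : n <= 2 ^ n.-1 by apply: leq_exp2_pred; lia.
pose lvl e q := [&& e < n.-1, excess a b e q == 0%R & left_over n.-1 a b (-1) e.+1 q].
(* The only candidate matched in round [e] within the class of [z]; the default 0 is harmless, as
   [theE] treats only the case where a candidate exists. *)
pose the e z := head 0 [seq q <- iota 0 (a + b) | lvl e q && eqm e z q].
have theE e z q : q < a + b -> lvl e q -> eqm e z q -> the e z = q.
  move=> hq hl hz; rewrite /the.
  have : q \in [seq q <- iota 0 (a + b) | lvl e q && eqm e z q].
    by rewrite mem_filter hl hz mem_iota.
  case E: filter => [//|q' l] /= _.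
  have : q' \in [seq q <- iota 0 (a + b) | lvl e q && eqm e z q].
    by rewrite E mem_head.
  rewrite mem_filter mem_iota /= add0n => /andP[/andP[/and3P[h1 /eqP h2 h3] h4] h5].
  apply: (@matched_level_uniq n.-1 a b (-1)%R e) => //; try lia.
    by rewrite eqm_sym; apply: eqm_trans h4; rewrite eqm_sym.
  by case/and3P: hl.
pose pair_of e := [:: the e a; the e (a + b)].
exists (flatten [seq pair_of e | e <- iota 0 k]).
  rewrite size_flatten /shape -map_comp sumnE big_map /=.
  by rewrite big_const_seq count_predT size_iota iter_addn_0 mulnC.
move=> q hq hd.
have hq' : maxn a b <= q < a + b by lia.
have [[e h] hp] := partner_matched (ltnW hn) hq'.
have hl : lvl e q by case/and5P: h => *; apply/and3P.
have [hz|nha] := boolP (eqm e a q); last have [hz|nhab] := boolP (eqm e (a + b) q).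
- have lt_e : e < k.
    (* For e at least k, congruence would force [q = a], whereas [q] is larger than [a]. *)
    rewrite ltnNge; apply/negP => le; have := eqm_le le hz; rewrite eqm_small; lia.
  apply/flattenP; exists (pair_of e); first by rewrite (map_f pair_of) // mem_iota.
  by rewrite -(theE _ _ _ _ hl hz) ?mem_head //; lia.
- have lt_e : e < k.
    rewrite ltnNge; apply/negP => le; have := eqm_le le hz; rewrite eqm_small; lia.
  apply/flattenP; exists (pair_of e); first by rewrite (map_f pair_of) // mem_iota.
  by rewrite -(theE _ _ _ _ hl hz) ?inE ?eqxx ?orbT //; lia.
case/eqP: hd; symmetry; apply: (partnerE (e := e)); first lia.
exact: matchedS.
Qed.

(* f_(a,b) of the introduction; n bounds the search for the partner. *)
Definition branch (n a b p : nat) : bool * nat :=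
  if p < a then (false, p) else (true, if p < b then p else partner n a b p).

Lemma branch_bound n a b p : a + b <= n -> p < a + b ->
  (branch n a b p).2 < if (branch n a b p).1 then b else a.
Proof.
move=> hn hp; rewrite /branch; case: (ltnP p a) => //= pa; case: (ltnP p b) => //= pb.
have hq : maxn a b <= p < a + b by lia.
by have [_] := partner_matched hn hq; lia.
Qed.

Lemma branch_inj n a b p q : a + b <= n -> p < a + b -> q < a + b ->
  branch n a b p = branch n a b q -> p = q.
Proof.
move=> hn hp hq; rewrite /branch.
have P x : maxn a b <= x < a + b -> partner n a b x < minn a b.
  by move=> hx; case: (partner_matched hn hx).
have I := partner_inj hn.
case: (ltnP p a) (ltnP q a) => [pa|pa] [qa|qa] //; first by case.
case=> /=; case: ltnP => pb; case: ltnP => qb //.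
- by have := P q; lia.
- by have := P p; lia.
- by apply: I; lia.
Qed.

(** [d] tells which side grows. Besides the changed partners, one number may change its rule: the
    old size of the side that grows. *)
Lemma branch_stable n k a b (d : bool) : a + b < n -> a + b < 2 ^ k ->
  exists2 s : seq nat, size s <= (k * 2).+1 &
    forall p, p < a + b ->
      branch n a b p != branch n (a + ~~ d) (b + d) p -> p \in s.
Proof.
move=> hn hk; case: d; rewrite /= ?addn0 ?addn1.
  have [||s hs h] := @partner_stable n k b a; rewrite 1?addnC //.
  exists (b :: s) => // p hp; rewrite /branch inE.
  case: (ltnP p a) => [|pa]; first by rewrite eqxx.
  have [//|npb] := eqVneq p b; rewrite ltnS [p <= b]leq_eqVlt (negbTE npb) /=.
  case: (ltnP p b) => pb; rewrite ?eqxx // => hd; apply: h; first lia.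
  by rewrite partnerC [X in _ != X]partnerC; apply: contra hd => /eqP->.
have [s hs h] := partner_stable hn hk.
exists (a :: s) => // p hp; rewrite /branch inE.
have [//|npa] := eqVneq p a; rewrite ltnS [p <= a]leq_eqVlt (negbTE npa) /=.
case: (ltnP p a) => [|pa]; first by rewrite eqxx.
case: (ltnP p b) => pb; rewrite ?eqxx // => hd.
by apply: h; [lia | apply: contra hd => /eqP->].
Qed.

(** * The descent through the tree of tasks *)

Definition weight (n : nat) (m : nat -> nat) (i c : nat) : nat :=
  \sum_(j < n) if eqm i j c then m j else 0.

Definition descend_step (n : nat) (m : nat -> nat) (i : nat) (x : nat * nat) :=
  let r := branch n (weight n m i.+1 x.1) (weight n m i.+1 (x.1 + 2 ^ i)) x.2 in
  (if r.1 then x.1 + 2 ^ i else x.1, r.2).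

(* The node (a residue mod 2^l) at depth l below which worker p works, and the
   number of p there; m gives the multiplicities of the tasks. *)
Definition descend (n : nat) (m : nat -> nat) (l p : nat) : nat * nat :=
  iteri l (descend_step n m) (0, p).

Lemma weight_split n m i c :
  weight n m i c = weight n m i.+1 c + weight n m i.+1 (c + 2 ^ i).
Proof.
rewrite /weight -big_split; apply: eq_bigr => j _ /=.
by have := eqm_split i j c; case: (eqm i j c); case: (eqm i.+1 j c); case: (eqm i.+1 j _); lia.
Qed.

Lemma weight_le n m i c : weight n m i c <= weight n m 0 0.
Proof. by apply: leq_sum => j _; rewrite /eqm !modn1; case: ifP. Qed.

Section Descend.
Variables (n : nat) (m : nat -> nat).
Hypothesis weight_n : weight n m 0 0 <= n.

Let weight_lt i c :
  weight n m i.+1 c + weight n m i.+1 (c + 2 ^ i) <= n.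
Proof. by rewrite -weight_split (leq_trans (weight_le _ _ _ _)). Qed.

Lemma descend_bound l p : p < weight n m 0 0 ->
  ((descend n m l p).1 < 2 ^ l) && ((descend n m l p).2 < weight n m l (descend n m l p).1).
Proof.
move=> hp; elim: l => [|l /andP[h1 h2]] //=.
rewrite weight_split in h2.
have := branch_bound (weight_lt _ _) h2.
set x := descend n m l p in h1 h2 *; rewrite expnS /descend_step -/x.
by case: (branch _ _ _ _) => -[] y /= ->; rewrite andbT; lia.
Qed.

(** Levels are undone one by one: nodes at depth l are below 2^l, so the new node reveals the old
    one and the side taken, and [branch] is injective at the old node. *)
Lemma descend_inj l p q : p < weight n m 0 0 -> q < weight n m 0 0 ->
  descend n m l p = descend n m l q -> p = q.
Proof.
move=> hp hq; elim: l => [[]//|l IH].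
have /andP[p1 p2] := descend_bound l hp; have /andP[q1 q2] := descend_bound l hq.
move: p1 p2 q1 q2 IH; rewrite /= /descend_step -/(descend n m l p) -/(descend n m l q).
move: (descend n m l p) (descend n m l q) => [c x] [c' x'] /= p1 p2 q1 q2 IH [].
move=> h1 h2; have [ecc er] : c = c' /\ 
  (branch n (weight n m l.+1 c) (weight n m l.+1 (c + 2 ^ l)) x).1 =
  (branch n (weight n m l.+1 c') (weight n m l.+1 (c' + 2 ^ l)) x').1.
  by move: h1; do 2 case: ifP; lia.
apply: IH; subst c'; congr pair; rewrite weight_split in p2 q2.
apply: (branch_inj (weight_lt l c) p2 q2).
by rewrite [LHS]surjective_pairing h2 er -surjective_pairing.
Qed.

(** Inserting task [j] alters weights only along the branch of [j], and injectivity of the descent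
    limits the workers affected at each of its nodes. From depth [L] on nothing changes, so the
    bound depends on [L] even if [l] is much larger. *)
Lemma descend_stable m' j k L l :
  (forall x, m' x = m x + (x == j)) -> weight n m 0 0 < n -> j < n -> 
  weight n m 0 0 < 2 ^ k -> j < 2 ^ L -> (forall x, 2 ^ L <= x -> m x = 0) ->
  exists2 s : seq nat, size s <= minn l L * (k * 2).+1 &
    forall p, p < weight n m 0 0 -> descend n m l p != descend n m' l p -> p \in s.
Proof.
move=> hm' hn hj hk hL hmL.
have hw i c : weight n m' i c = weight n m i c + eqm i j c.
  rewrite /weight (bigD1 (Ordinal hj)) //= [in RHS](bigD1 (Ordinal hj)) //= hm' eqxx.
  rewrite (eq_bigr (fun x : 'I_n => if eqm i x c then m x else 0)); first by case: eqm; lia.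
  by move=> x; rewrite -val_eqE hm' => /negbTE->; rewrite addn0.
elim: l => [|l [s hs IH]]; first by exists [::] => // p _; rewrite eqxx.
set c0 := j %% 2 ^ l.
have hc c : c < 2 ^ l -> eqm l j c = (c == c0).
  by move=> h; rewrite /eqm (modn_small h) eq_sym.
set a := weight n m l.+1 c0; set b := weight n m l.+1 (c0 + 2 ^ l).
have hab : a + b <= weight n m 0 0 by rewrite /a /b -weight_split weight_le.
have [s1 hs1 h1] : exists2 s1 : seq nat,
    size s1 <= (if l < L then (k * 2).+1 else 0) &
    forall p, p < a + b -> branch n a b p !=
      branch n (weight n m' l.+1 c0) (weight n m' l.+1 (c0 + 2 ^ l)) p -> p \in s1.
  rewrite !hw -/a -/b.
  have hd : eqm l.+1 j c0 = ~~ eqm l.+1 j (c0 + 2 ^ l).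
    have := eqm_split l j c0; rewrite {1}/eqm modn_mod eqxx.
    by do 2 case: eqm.
  rewrite hd; case: (ltnP l L) => [lL|Ll]; first by apply: branch_stable; lia.
  exists [::] => // p hp.
  have e2 : 2 ^ L <= 2 ^ l by rewrite leq_exp2l.
  (* At this depth the node is [j] itself and its other child is empty, so every worker stays on the
     first side. *)
  have ej : c0 = j by rewrite /c0 modn_small //; lia.
  have hd2 : eqm l.+1 j (c0 + 2 ^ l) = false.
    by move: hd; rewrite {1}ej eqm_refl; case: eqm.
  have b0 : b = 0.
    rewrite /b /weight big1 // => x _; case: ifP => // hx; apply: hmL.
    rewrite leqNgt; apply/negP => xL.
    by move: hx; rewrite ej eqm_small ?expnS; lia.
  have pa : p < a by lia.
  by rewrite hd2 /branch /= pa addn1 ltnS (ltnW pa) eqxx.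
(* The workers that reach the altered node with a number in [s1]. By [descend_inj] there are no more
   of them than elements of [s1]. *)
pose s2 := [seq p <- iota 0 (weight n m 0 0) |
  ((descend n m l p).1 == c0) && ((descend n m l p).2 \in s1)].
exists (s ++ s2).
  rewrite size_cat; have : size s2 <= size s1.
    rewrite -(size_map (fun p => (descend n m l p).2)); apply: uniq_leq_size.
      rewrite map_inj_in_uniq ?filter_uniq ?iota_uniq // => p q.
      rewrite !mem_filter !mem_iota /= !add0n.
      move=> /andP[/andP[/eqP p1 _] p2] /andP[/andP[/eqP q1 _] q2] e.
      by apply: (@descend_inj l) => //; rewrite [LHS]surjective_pairing p1 e -q1 -surjective_pairing.
    by move=> x /mapP[p]; rewrite mem_filter => /andP[/andP[_ h] _] ->.
  move: hs1; case: ltnP => lL; move: hs.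
    by rewrite !(minn_idPl _) // ?(ltnW lL) // mulSn; lia.
  by rewrite !(minn_idPr _) // ?(leqW lL); lia.
move=> p hp hd; rewrite mem_cat; have [e|/IH->//] := eqVneq (descend n m l p) (descend n m' l p).
rewrite mem_filter mem_iota /= add0n hp andbT; apply/orP; right.
have /andP[p1 p2] := descend_bound l hp.
move: hd; rewrite /= /descend_step -/(descend n m l p) -/(descend n m' l p) -e.
have [ec|nc] := eqVneq (descend n m l p).1 c0; last first.
  have h0 : eqm l j (descend n m l p).1 = false by rewrite hc // (negbTE nc).
  have := eqm_split l j (descend n m l p).1; rewrite h0 !hw.
  by do 2 case: (eqm l.+1); rewrite // !addn0 eqxx.
rewrite ec => hd; apply: h1; first by rewrite /a /b -weight_split -ec.
by apply: contra hd => /eqP<-.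
Qed.
End Descend.

(** * Polynomial-time programs *)

(** Total correctness with a time bound. The postcondition is a predicate, so that sequences of
    instructions are verified by nesting. *)
Definition runs (B : nat) (p : prog) (s : state) (Q : state -> Prop) : Prop :=
  exists n s', [/\ exec p s n s', n <= B & Q s'].

Lemma runs_weaken B B' p s (Q Q' : state -> Prop) :
  runs B p s Q -> B <= B' -> (forall s', Q s' -> Q' s') -> runs B' p s Q'.
Proof.
by move=> [n [s' [h1 h2 h3]]] hB hQ; exists n, s'; split; [|lia|exact: hQ].
Qed.

Lemma runs_const x c s (Q : state -> Prop) :
  Q (set_reg s x c) -> runs 1 (IConst x c) s Q.
Proof. by move=> h; exists 1, (set_reg s x c); split=> //; constructor. Qed.

Lemma runs_add x y z s (Q : state -> Prop) :
  Q (set_reg s x (reg s y + reg s z)) -> runs 1 (IAdd x y z) s Q.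
Proof. by move=> h; eexists 1, _; split; [constructor| |exact: h]. Qed.

Lemma runs_sub x y z s (Q : state -> Prop) :
  Q (set_reg s x (reg s y - reg s z)) -> runs 1 (ISub x y z) s Q.
Proof. by move=> h; eexists 1, _; split; [constructor| |exact: h]. Qed.

Lemma runs_read x y s (Q : state -> Prop) :
  Q (set_reg s x (cell s (reg s y))) -> runs 1 (IRead x y) s Q.
Proof. by move=> h; eexists 1, _; split; [constructor| |exact: h]. Qed.

Lemma runs_write x y s (Q : state -> Prop) :
  Q (set_mem s (reg s x) (reg s y)) -> runs 1 (IWrite x y) s Q.
Proof. by move=> h; eexists 1, _; split; [constructor| |exact: h]. Qed.

Lemma runs_seq B B' p q s Q :
  runs B p s (fun s' => runs B' q s' Q) -> runs (B + B') (ISeq p q) s Q.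
Proof.
move=> [n [s' [h1 h2 [n' [s'' [h3 h4 h5]]]]]].
by exists (n + n'), s''; split=> //; [exact: exec_seq h1 h3|lia].
Qed.

Lemma runs_if B x p q s Q :
  (reg s x != 0 -> runs B p s Q) -> (reg s x = 0 -> runs B q s Q) ->
  runs B.+1 (IIf x p q) s Q.
Proof.
move=> hp hq; have [x0|x0] := eqVneq (reg s x) 0.
  by have [n [s' [h1 h2 h3]]] := hq x0; exists n.+1, s'; split=> //; exact: exec_if_false.
by have [n [s' [h1 h2 h3]]] := hp x0; exists n.+1, s'; split=> //; exact: exec_if_true.
Qed.

(* Every loop runs [reg s 2] times, which is w + t in the end: this makes all
   running times polynomial. Register [k.+1] is scratch. *)
Definition loop (k : nat) (p : prog) : prog :=
  ISeq (IConst k 0) (ISeq (IAdd k k 2)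
    (IWhile k (ISeq p (ISeq (IConst k.+1 1) (ISub k k k.+1))))).

(** The invariant may not depend on the counter and the scratch register, and the body must restore
    the counter. Each round adds a test and two instructions to the body; the other 3 steps are
    initialization and the last test. *)
Lemma runs_loop B k p s (Inv : nat -> state -> Prop) (Q : state -> Prop) : 2 < k ->
  (forall i s s', (forall x, x != k -> x != k.+1 -> reg s' x = reg s x) ->
    cell s' = cell s -> Inv i s -> Inv i s') ->
  (forall i s', i < reg s 2 -> Inv i s' ->
    runs B p s' (fun s'' => Inv i.+1 s'' /\ reg s'' k = reg s' k)) ->
  Inv 0 s ->
  (forall s', Inv (reg s 2) s' -> Q s') ->
  runs (3 + reg s 2 * (B + 3)) (loop k p) s Q.
Proof.
move=> k2 hInv hbody h0 hQ; set Z := reg s 2 in hbody hQ *.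
have hw j s1 : j <= Z -> Inv (Z - j) s1 -> reg s1 k = j ->
    runs (1 + j * (B + 3)) (IWhile k (ISeq p (ISeq (IConst k.+1 1) (ISub k k k.+1)))) s1 Q.
  elim: j s1 => [|j IH] s1 hj h1 hk.
    exists 1, s1; split=> //; first exact: exec_while_false.
    by apply: hQ; rewrite -[Z]subn0.
  have [|n [s2 [e1 e2 [e3 e4]]]] := hbody (Z - j.+1) s1 _ h1; first lia.
  rewrite subnSK // in e3.
  set s3 := set_reg s2 k.+1 1.
  set s4 := set_reg s3 k (reg s3 k - reg s3 k.+1).
  have hk4 : reg s4 k = j.
    by rewrite /s4 /s3 /= /upd !eqxx eqn_leq ltnn andbF e4 hk subn1.
  have [|n' [s5 [f1 f2 f3]]] := IH s4 (ltnW hj) _ hk4.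
    apply: (hInv _ s2) => // x x1 x2.
    by rewrite /s4 /s3 /= /upd (negbTE x1) (negbTE x2).
  exists ((n + (1 + 1)) + n').+1, s5; split=> //; last by rewrite mulSn; lia.
  apply: exec_while_true f1; first by rewrite hk.
  by apply: exec_seq e1 _; apply: exec_seq; constructor.
apply: (@runs_seq 1 (1 + (1 + Z * (B + 3)))); apply: runs_const; apply: runs_seq; apply: runs_add.
set s1 := set_reg _ _ _.
apply: hw => //.
  rewrite subnn; apply: hInv h0 => // x x1 x2.
  by rewrite /s1 /= /upd (negbTE x1).
by rewrite /s1 /= /upd !eqxx; case: eqP => // e; lia.
Qed.

(** * Functions computable in polynomial time *)

Definition poly_bounded (B : nat -> nat) : Prop :=
  exists d, forall z, 4 <= z -> B z <= z ^ d.

Lemma pb_const c : poly_bounded (fun=> c).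
Proof.
exists c => z hz; apply: ltnW; apply: ltn_expl; lia.
Qed.

Lemma pb_id : poly_bounded id.
Proof. by exists 1 => z hz; rewrite expn1. Qed.

Lemma pb_mul B B' : poly_bounded B -> poly_bounded B' ->
  poly_bounded (fun z => B z * B' z).
Proof.
move=> [d h] [d' h']; exists (d + d') => z hz.
by rewrite expnD leq_mul ?h ?h'.
Qed.

Lemma pb_add B B' : poly_bounded B -> poly_bounded B' ->
  poly_bounded (fun z => B z + B' z).
Proof.
move=> [d h] [d' h']; exists (1 + (d + d')) => z hz.
have z1 e : 0 < z ^ e by rewrite expn_gt0; lia.
rewrite !expnD expn1; have := h _ hz; have := h' _ hz.
move: (z1 d) (z1 d'); move: (z ^ d) (z ^ d') => x y.
(* For x, y >= 1 the sum is at most 2xy, and the additional factor z absorbs the 2. *)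
by move=> x0 y0 h1 h2; apply: (@leq_trans (2 * (x * y))); [nia|rewrite leq_mul2r; lia].
Qed.

(* The arguments of [f] are the content of register 2, the memory and a list of
   numbers found in arbitrary registers below [k]; the value is left in register
   [k]. Time is measured in the first argument alone, and nothing below [k] is
   overwritten, so that programs can be nested. *)
Definition computable (f : nat -> (nat -> nat) -> seq nat -> nat) : Prop :=
  forall xs k, 2 < k -> all (fun x => x < k) xs ->
  exists p B, poly_bounded B /\ forall s, 4 <= reg s 2 ->
    runs (B (reg s 2)) p s (fun s' =>
      [/\ reg s' k = f (reg s 2) (cell s) [seq reg s x | x <- xs],
          forall x, x < k -> reg s' x = reg s x & cell s' = cell s]).

Lemma map_reg s s' k xs : all (fun x => x < k) xs ->
  (forall x, x < k -> reg s' x = reg s x) ->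
  [seq reg s' x | x <- xs] = [seq reg s x | x <- xs].
Proof. by move=> /allP h e; apply/eq_in_map => x /h /e. Qed.

Lemma all_ltW k k' xs : k <= k' -> all (fun x => x < k) xs -> all (fun x => x < k') xs.
Proof. by move=> h; apply: sub_all => x hx; exact: leq_trans h. Qed.

Lemma updE f a v : upd f a v a = v. Proof. by rewrite /upd eqxx. Qed.
Lemma upd_neq f a v x : x != a -> upd f a v x = f x.
Proof. by rewrite /upd => /negbTE->. Qed.
Lemma upd_lt f a v x : x < a -> upd f a v x = f x.
Proof. by move=> h; rewrite upd_neq // neq_ltn h. Qed.

Lemma computable_num c : computable (fun _ _ _ => c).
Proof.
move=> xs k k2 hxs; exists (IConst k c), (fun=> 1); split; first exact: pb_const.
move=> s _; apply: runs_const; split=> //=; first by rewrite updE.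
by move=> x hx; rewrite upd_lt.
Qed.

Lemma computable_bound : computable (fun z _ _ => z).
Proof.
move=> xs k k2 hxs; exists (ISeq (IConst k 0) (IAdd k 2 k)), (fun=> 1 + 1).
split; first exact: pb_const.
move=> s _; apply: runs_seq; apply: runs_const; apply: runs_add.
split=> //=; first by rewrite !updE upd_lt // addn0.
by move=> x hx; rewrite !upd_lt.
Qed.

Lemma computable_arg i : computable (fun _ _ v => nth 0 v i).
Proof.
move=> xs k k2 hxs; have [hi|hi] := ltnP i (size xs); last first.
  have [p [B [hB h]]] := computable_num 0 k2 hxs.
  exists p, B; split=> // s /h hs; apply: runs_weaken hs (leqnn _) _ => s' [-> h2 h3].
  by split=> //; rewrite nth_default ?size_map.
exists (ISeq (IConst k 0) (IAdd k (nth 0 xs i) k)), (fun=> 1 + 1); split; first exact: pb_const.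
have hy : nth 0 xs i < k by apply: (allP hxs); exact: mem_nth.
move=> s _; apply: runs_seq; apply: runs_const; apply: runs_add.
split=> //=; first by rewrite !updE upd_lt // addn0 (nth_map 0).
by move=> x hx; rewrite !upd_lt.
Qed.

Lemma computable_binop (op : nat -> nat -> nat) (I : nat -> nat -> nat -> prog) f g :
  (forall x y z s (Q : state -> Prop), Q (set_reg s x (op (reg s y) (reg s z))) ->
     runs 1 (I x y z) s Q) ->
  computable f -> computable g ->
  computable (fun z m v => op (f z m v) (g z m v)).
Proof.
move=> hI hf hg xs k k2 hxs; have [p [B [hB h]]] := hf xs k k2 hxs.
have [p' [B' [hB' h']]] := hg xs k.+1 (ltnW k2) (all_ltW (leqnSn k) hxs).
exists (ISeq p (ISeq p' (I k k k.+1))), (fun z => B z + (B' z + 1)); split.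
  by do 2! [apply: pb_add => //]; exact: pb_const.
move=> s hs; apply: runs_seq; apply: runs_weaken (h _ hs) (leqnn _) _ => s1 [e1 e2 e3].
have z1 : reg s1 2 = reg s 2 by rewrite e2.
rewrite -z1; apply: runs_seq; rewrite -z1 in hs.
apply: runs_weaken (h' _ hs) (leqnn _) _ => s2 [f1 f2 f3].
apply: hI; split=> /=; last by rewrite f3.
  by rewrite updE f2 // e1 f1 z1 e3 (map_reg hxs e2).
by move=> x hx; rewrite upd_lt // f2 ?e2 // ltnS ltnW.
Qed.

Lemma computable_add f g : computable f -> computable g ->
  computable (fun z m v => f z m v + g z m v).
Proof. by apply: computable_binop => x y z s Q h; exact: runs_add h. Qed.

Lemma computable_sub f g : computable f -> computable g ->
  computable (fun z m v => f z m v - g z m v).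
Proof. by apply: computable_binop => x y z s Q h; exact: runs_sub h. Qed.

Lemma computable_cell f : computable f -> computable (fun z m v => m (f z m v)).
Proof.
move=> hf xs k k2 hxs; have [p [B [hB h]]] := hf xs k k2 hxs.
exists (ISeq p (IRead k k)), (fun z => B z + 1); split.
  by apply: pb_add => //; exact: pb_const.
move=> s hs; apply: runs_seq; apply: runs_weaken (h _ hs) (leqnn _) _ => s1 [e1 e2 e3].
apply: runs_read; split=> //=; first by rewrite updE e1 e3.
by move=> x hx; rewrite upd_lt // e2.
Qed.

Lemma computable_if (b : nat -> (nat -> nat) -> seq nat -> bool) f g :
  computable (fun z m v => b z m v) -> computable f -> computable g ->
  computable (fun z m v => if b z m v then f z m v else g z m v).
Proof.
move=> hb hf hg xs k k2 hxs; have [p [B [hB h]]] := hb xs k k2 hxs.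
have [p1 [B1 [hB1 h1]]] := hf xs k k2 hxs.
have [p2 [B2 [hB2 h2]]] := hg xs k k2 hxs.
exists (ISeq p (IIf k p1 p2)), (fun z => B z + (B1 z + B2 z + 1)); split.
  by do 2! [apply: pb_add => //; try exact: pb_const]; exact: pb_add.
move=> s hs; apply: runs_seq; apply: runs_weaken (h _ hs) (leqnn _) _ => s1 [e1 e2 e3].
have z1 : reg s1 2 = reg s 2 by rewrite e2.
rewrite -z1 in hs; rewrite addn1; apply: runs_if; rewrite e1 => hc.
  apply: runs_weaken (h1 _ hs) _ _; first by rewrite z1 leq_addr.
  move=> s2 [f1 f2 f3]; split; last by rewrite f3.
    by rewrite f1 z1 e3 (map_reg hxs e2); move: hc; case: (b _ _ _).
  by move=> x hx; rewrite f2 ?e2.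
apply: runs_weaken (h2 _ hs) _ _; first by rewrite z1 leq_addl.
move=> s2 [f1 f2 f3]; split; last by rewrite f3.
  by rewrite f1 z1 e3 (map_reg hxs e2); move: hc; case: (b _ _ _).
by move=> x hx; rewrite f2 ?e2.
Qed.

Lemma computable_let f g : computable f -> computable g ->
  computable (fun z m v => f z m (g z m v :: v)).
Proof.
move=> hf hg xs k k2 hxs; have [p [B [hB h]]] := hg xs k k2 hxs.
have hxs' : all (fun x => x < k.+1) (k :: xs) by rewrite /= leqnn (all_ltW (leqnSn k)).
have [p' [B' [hB' h']]] := hf (k :: xs) k.+1 (ltnW k2) hxs'.
exists (ISeq p (ISeq p' (ISeq (IConst k.+2 0) (IAdd k k.+1 k.+2)))).
exists (fun z => B z + (B' z + (1 + 1))); split.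
  by do 2! [apply: pb_add => //]; exact: pb_const.
move=> s hs; apply: runs_seq; apply: runs_weaken (h _ hs) (leqnn _) _ => s1 [e1 e2 e3].
have z1 : reg s1 2 = reg s 2 by rewrite e2.
rewrite -z1; apply: runs_seq; rewrite -z1 in hs.
apply: runs_weaken (h' _ hs) (leqnn _) _ => s2 [f1 f2 f3].
apply: runs_seq; apply: runs_const; apply: runs_add; split=> /=; last by rewrite f3.
  by rewrite !updE upd_lt // f1 z1 e3 /= e1 (map_reg hxs e2) addn0.
by move=> x hx; rewrite !upd_lt ?f2 ?e2 //; lia.
Qed.

Lemma computable_drop i f : computable f -> computable (fun z m v => f z m (drop i v)).
Proof.
move=> hf xs k k2 hxs; have [|p [B [hB h]]] := hf (drop i xs) k k2.
  by apply/allP => x /mem_drop; exact: (allP hxs).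
exists p, B; split=> // s hs; rewrite -map_drop; exact: h.
Qed.

Lemma computable_ext f g : (forall z m v, f z m v = g z m v) -> computable f -> computable g.
Proof.
move=> e hf xs k k2 hxs; have [p [B [hB h]]] := hf xs k k2 hxs.
by exists p, B; split=> // s /h; rewrite e.
Qed.

(** Composition. The values of [gs] are pushed from the last to the first, and [drop] hides from
    each of them the values already pushed. *)
Lemma computable_call f (gs : seq (nat -> (nat -> nat) -> seq nat -> nat)) :
  computable f -> foldr (fun g P => computable g /\ P) True gs ->
  computable (fun z m v => f z m ([seq g z m v | g <- gs] ++ v)).
Proof.
elim: gs f => [|g gs IH] f hf /=; first by [].
move=> [hg hgs]; have hf' := computable_let hf (computable_drop (size gs) hg).
apply: computable_ext (IH _ hf' hgs) => z m v /=.
by rewrite -{1}(size_map (fun g => g z m v) gs) drop_size_cat.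
Qed.

Definition iterate (z : nat) (g1 g2 : nat -> nat -> nat -> nat) (a1 a2 : nat) : nat * nat :=
  iteri z (fun i a => (g1 a.1 a.2 i, g2 a.1 a.2 i)) (a1, a2).

(** Registers [k], [k + 1], [k + 2] hold the pair and the index, [k + 3] and [k + 4] serve the loop.
    The new pair is formed in [k + 5] and [k + 6], since both step functions need the old one. *)
Lemma computable_iterate f1 f2 g1 g2 :
  computable f1 -> computable f2 -> computable g1 -> computable g2 ->
  computable (fun z m v =>
    (iterate z (fun a b i => g1 z m [:: a, b, i & v]) (fun a b i => g2 z m [:: a, b, i & v])
       (f1 z m v) (f2 z m v)).1).
Proof.
move=> hf1 hf2 hg1 hg2 xs k k2 hxs.
have [p1 [B1 [hB1 h1]]] := hf1 xs k k2 hxs.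
have [p2 [B2 [hB2 h2]]] := hf2 xs k.+1 (ltnW k2) (all_ltW (leqnSn k) hxs).
set ys := [:: k, k.+1, k.+2 & xs].
have hys j : k + 3 <= j -> all (fun x => x < j) ys.
  by move=> hj; rewrite /= (@all_ltW k) ?andbT //; lia.
have [||q1 [C1 [hC1 c1]]] := hg1 ys (k + 5); [lia|apply: hys; lia|].
have [||q2 [C2 [hC2 c2]]] := hg2 ys (k + 6); [lia|apply: hys; lia|].
pose body := ISeq q1 (ISeq q2 (ISeq (IConst (k + 7) 0) (ISeq (IAdd k (k + 5) (k + 7))
  (ISeq (IAdd k.+1 (k + 6) (k + 7)) (ISeq (IConst (k + 7) 1) (IAdd k.+2 k.+2 (k + 7))))))).
exists (ISeq p1 (ISeq p2 (ISeq (IConst k.+2 0) (loop (k + 3) body)))).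
exists (fun z => B1 z + (B2 z +
  (1 + (3 + z * (C1 z + (C2 z + (1 + (1 + (1 + (1 + 1))))) + 3))))); split.
  by repeat first [exact: pb_const | exact: pb_id | apply: pb_add => // | apply: pb_mul => // ].
move=> s hs; apply: runs_seq; apply: runs_weaken (h1 _ hs) (leqnn _) _ => s1 [e1 e2 e3].
have z1 : reg s1 2 = reg s 2 by rewrite e2.
rewrite -z1; apply: runs_seq; rewrite -z1 in hs.
apply: runs_weaken (h2 _ hs) (leqnn _) _ => s2 [f1' f2' f3'].
have z2 : reg s2 2 = reg s1 2 by rewrite f2' //; lia.
apply: runs_seq; apply: runs_const; set s3 := set_reg _ _ _.
have z3 : reg s3 2 = reg s1 2 by rewrite /= upd_lt //; lia.
rewrite -[X in runs (3 + X * _) _ _ _]z3.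
set Z := reg s1 2 in z1 z2 z3 hs f1' *; set v := [seq reg s x | x <- xs].
set F := fun i => iterate i (fun a b i => g1 Z (cell s) [:: a, b, i & v])
  (fun a b i => g2 Z (cell s) [:: a, b, i & v]) (f1 Z (cell s) v) (f2 Z (cell s) v).
pose Inv i t := [/\ reg t k = (F i).1, reg t k.+1 = (F i).2, reg t k.+2 = i,
  forall x, x < k -> reg t x = reg s x & cell t = cell s].
apply: (runs_loop (Inv := Inv)) => //; first lia.
- move=> i t t' ht hm [i1 i2 i3 i4 i5]; split; rewrite ?ht ?hm //; try lia.
  by move=> x hx; rewrite ht ?i4 //; lia.
- rewrite z3 => i t hi [i1 i2 i3 i4 i5].
  have zt : reg t 2 = Z by rewrite i4 // z1.
  have ht : 4 <= reg t 2 by rewrite zt.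
  rewrite -zt; apply: runs_seq; apply: runs_weaken (c1 _ ht) (leqnn _) _ => t1 [j1 j2 j3].
  have zt1 : reg t1 2 = reg t 2 by rewrite j2 //; lia.
  rewrite -zt1 in ht *; apply: runs_seq; apply: runs_weaken (c2 _ ht) (leqnn _) _ => t2 [l1 l2 l3].
  have ev : [seq reg t x | x <- ys] = [:: (F i).1, (F i).2, i & v].
    by rewrite /= i1 i2 i3 (map_reg hxs i4).
  have ev1 : [seq reg t1 x | x <- ys] = [:: (F i).1, (F i).2, i & v].
    by rewrite -ev; apply: map_reg (hys (k + 3) (leqnn _)) _ => x hx; rewrite j2 //; lia.
  rewrite ev zt i5 in j1; rewrite ev1 zt1 zt j3 i5 in l1.
  apply: runs_seq; apply: runs_const; apply: runs_seq; apply: runs_add.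
  apply: runs_seq; apply: runs_add; apply: runs_seq; apply: runs_const; apply: runs_add.
  have L x : x < k + 3 -> reg t2 x = reg t x by move=> hx; rewrite l2 ?j2 //; lia.
  split; last by rewrite /= !upd_neq ?l2 ?j2 //; lia.
  split=> /=.
  + rewrite upd_lt // upd_lt; last lia.
    rewrite upd_lt // updE updE upd_lt; last lia.
    by rewrite addn0 l2 ?j1 //; lia.
  + rewrite upd_lt // upd_lt; last lia.
    rewrite updE upd_neq; last lia.
    rewrite upd_lt; last lia.
    by rewrite upd_neq ?updE ?addn0 ?l1 //; lia.
  + rewrite !updE addn1; congr _.+1; do 4! [rewrite upd_neq; last lia].
    by rewrite L ?i3 //; lia.
  + by move=> x hx; rewrite !upd_lt ?L ?i4 //; lia.
  + by rewrite l3 j3.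
- split=> //=.
  + rewrite upd_lt; last lia.
    by rewrite f2' // e1 -z1.
  + by rewrite upd_lt // f1' e3 (map_reg hxs e2).
  + by rewrite updE.
  + by move=> x hx; rewrite upd_lt ?f2' ?e2 //; lia.
  + by rewrite f3' e3.
by move=> t; rewrite z3 => -[i1 i2 i3 i4 i5]; split.
Qed.

Lemma computable_leq f g : computable f -> computable g ->
  computable (fun z m v => f z m v <= g z m v).
Proof.
move=> hf hg; apply: computable_ext (computable_sub (computable_num 1) (computable_sub hf hg)).
by move=> z m v /=; rewrite -subn_eq0; case: (f z m v - g z m v).
Qed.

Lemma computable_ltn f g : computable f -> computable g ->
  computable (fun z m v => f z m v < g z m v).
Proof.
move=> hf hg; apply: computable_leq hg.
by apply: computable_ext (computable_add hf (computable_num 1)) => z m v; rewrite addn1.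
Qed.

Lemma computable_and (b c : nat -> (nat -> nat) -> seq nat -> bool) :
  computable (fun z m v => b z m v) -> computable (fun z m v => c z m v) ->
  computable (fun z m v => b z m v && c z m v).
Proof.
move=> hb hc; apply: computable_ext (computable_if hb hc (computable_num 0)).
by move=> z m v; case: (b z m v).
Qed.

Lemma computable_imply (b c : nat -> (nat -> nat) -> seq nat -> bool) :
  computable (fun z m v => b z m v) -> computable (fun z m v => c z m v) ->
  computable (fun z m v => b z m v ==> c z m v).
Proof.
move=> hb hc; apply: computable_ext (computable_if hb hc (computable_num 1)).
by move=> z m v; case: (b z m v).
Qed.

Lemma computable_eq f g : computable f -> computable g ->
  computable (fun z m v => f z m v == g z m v).
Proof.
move=> hf hg; apply: computable_ext (computable_and (computable_leq hf hg) (computable_leq hg hf)).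
by move=> z m v; rewrite -eqn_leq.
Qed.

Lemma computable_sum f : computable f ->
  computable (fun z m v => \sum_(i < z) f z m ((i : nat) :: v)).
Proof.
move=> hf.
have h0 := computable_num 0.
(* [drop 2] removes the pair that is being iterated, so that the index heads the argument list. *)
have h1 := computable_add (computable_arg 0) (computable_drop 2 hf).
apply: computable_ext (computable_iterate h0 h0 h1 h0) => z m v.
rewrite /iterate; set g := fun _ _ => _.
have E n : iteri n g (0, 0) = (\sum_(i < n) f z m ((i : nat) :: v), 0).
  elim: n => [|n IH]; first by rewrite big_ord0.
  by rewrite big_ord_recr /= IH /g /= ?drop0.
by rewrite E.
Qed.

Lemma computable_has (b : nat -> (nat -> nat) -> seq nat -> bool) :
  computable (fun z m v => b z m v) ->
  computable (fun z m v => has (fun i => b z m (i :: v)) (iota 0 z)).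
Proof.
move=> hb; apply: computable_ext (computable_ltn (computable_num 0) (computable_sum hb)) => z m v.
congr nat_of_bool; rewrite lt0n sum_nat_eq0; apply/forallPn/hasP => [[i]|[i]].
  by rewrite eqb0 negbK => h; exists (i : nat); rewrite ?mem_iota /=.
by rewrite mem_iota /= => hi h; exists (Ordinal hi); rewrite h.
Qed.

Lemma computable_all (b : nat -> (nat -> nat) -> seq nat -> bool) :
  computable (fun z m v => b z m v) ->
  computable (fun z m v => all (fun i => b z m (i :: v)) (iota 0 z)).
Proof.
move=> hb.
have hn : computable (fun z m v => ~~ b z m v).
  by apply: computable_ext (computable_sub (computable_num 1) hb) => z m v; case: (b z m v).
apply: computable_ext (computable_sub (computable_num 1) (computable_has hn)) => z m v.
rewrite has_predC; by case: (all _ _).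
Qed.

Lemma computable_call2 (F : nat -> (nat -> nat) -> nat -> nat -> nat) a b :
  computable (fun z m v => F z m (nth 0 v 0) (nth 0 v 1)) ->
  computable a -> computable b -> computable (fun z m v => F z m (a z m v) (b z m v)).
Proof. by move=> hF ha hb; exact: (@computable_call _ [:: a; b] hF). Qed.

Lemma computable_call3 (F : nat -> (nat -> nat) -> nat -> nat -> nat -> nat) a b c :
  computable (fun z m v => F z m (nth 0 v 0) (nth 0 v 1) (nth 0 v 2)) ->
  computable a -> computable b -> computable c ->
  computable (fun z m v => F z m (a z m v) (b z m v) (c z m v)).
Proof. by move=> hF ha hb hc; exact: (@computable_call _ [:: a; b; c] hF). Qed.

Lemma computable_call4 (F : nat -> (nat -> nat) -> nat -> nat -> nat -> nat -> nat) a b c d :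
  computable (fun z m v => F z m (nth 0 v 0) (nth 0 v 1) (nth 0 v 2) (nth 0 v 3)) ->
  computable a -> computable b -> computable c -> computable d ->
  computable (fun z m v => F z m (a z m v) (b z m v) (c z m v) (d z m v)).
Proof. by move=> hF ha hb hc hd; exact: (@computable_call _ [:: a; b; c; d] hF). Qed.

(* [modz], ..., [taskz] are [modn], ..., [descend] with all loops bounded by z;
   they agree for arguments that are small enough compared with z. *)
Definition modz (z x y : nat) : nat :=
  (iterate z (fun a _ _ => if y <= a then a - y else a) (fun _ _ _ => 0) x 0).1.

Definition powz (z e : nat) : nat :=
  (iterate z (fun a _ i => if i < e then a + a else a) (fun _ _ _ => 0) 1 0).1.

Definition eqmz (z e x y : nat) : bool := modz z x (powz z e) == modz z y (powz z e).

Definition cntz (z e c x : nat) : nat := \sum_(y < z) (y < x) && eqmz z e y c.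

(** The test that the excess is k2 - k1, with all terms moved to where they are added: the machine
    has neither negative numbers nor exact subtraction. *)
Definition excessz (k1 k2 z a b e c : nat) : bool :=
  cntz z e c a + cntz z e c b + k1 == cntz z e c (a + b) + k2.

Definition left_overz (k1 k2 z a b e p : nat) : bool :=
  all (fun e' => (e <= e') ==> excessz k1 k2 z a b e' p) (iota 0 z).

Definition matchedz (z a b e p q : nat) : bool :=
  (e.+1 < z) && (excessz 0 0 z a b e q && (eqmz z e p q &&
    (left_overz 0 1 z a b e.+1 p && left_overz 1 0 z a b e.+1 q))).

Definition partnerz (z a b q : nat) : nat :=
  \sum_(p < z) if has (fun e => matchedz z a b e p q) (iota 0 z) then p : nat else 0.

Definition weightz (z : nat) (m : nat -> nat) (i c : nat) : nat :=
  \sum_(j < z) if eqmz z i j c then m j else 0.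

Definition taskz (z : nat) (m : nat -> nat) (p : nat) : nat :=
  (iterate z
    (fun c x i => if x < weightz z m i.+1 c then c else c + powz z i)
    (fun c x i => if x < weightz z m i.+1 c then x else
       if x < weightz z m i.+1 (c + powz z i) then x else
       partnerz z (weightz z m i.+1 c) (weightz z m i.+1 (c + powz z i)) x) 0 p).1.

(** * Computability of the bounded functions *)

Lemma computable_modz f g : computable f -> computable g ->
  computable (fun z m v => modz z (f z m v) (g z m v)).
Proof.
apply: (computable_call2 (F := fun z _ => modz z)).
have hg := computable_if (computable_leq (computable_arg 4) (computable_arg 0))
  (computable_sub (computable_arg 0) (computable_arg 4)) (computable_arg 0).
exact: (computable_iterate (computable_arg 0) (computable_num 0) hg (computable_num 0)).
Qed.

Lemma computable_powz f : computable f -> computable (fun z m v => powz z (f z m v)).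
Proof.
move=> hf; apply: (computable_call2 (F := fun z _ x y => powz z x)) => //; last exact: hf.
have hg := computable_if (computable_ltn (computable_arg 2) (computable_arg 3))
  (computable_add (computable_arg 0) (computable_arg 0)) (computable_arg 0).
exact: (computable_iterate (computable_num 1) (computable_num 0) hg (computable_num 0)).
Qed.

Lemma computable_eqmz f g h : computable f -> computable g -> computable h ->
  computable (fun z m v => eqmz z (f z m v) (g z m v) (h z m v)).
Proof.
move=> hf hg hh; have hp := computable_powz hf.
by apply: computable_eq; apply: computable_modz.
Qed.

Lemma computable_cntz f g h : computable f -> computable g -> computable h ->
  computable (fun z m v => cntz z (f z m v) (g z m v) (h z m v)).
Proof.
apply: (computable_call3 (F := fun z _ => cntz z)).
apply: (computable_sum (f := fun z m v =>
  (nth 0 v 0 < nth 0 v 3) && eqmz z (nth 0 v 1) (nth 0 v 0) (nth 0 v 2))).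
apply: computable_and; first by apply: computable_ltn; exact: computable_arg.
by apply: computable_eqmz; exact: computable_arg.
Qed.

Lemma computable_excessz k1 k2 f g h i :
  computable f -> computable g -> computable h -> computable i ->
  computable (fun z m v => excessz k1 k2 z (f z m v) (g z m v) (h z m v) (i z m v)).
Proof.
move=> hf hg hh hi; apply: computable_eq.
  apply: computable_add (computable_num _).
  by apply: computable_add; exact: computable_cntz.
by apply: computable_add (computable_num _); apply: computable_cntz => //; exact: computable_add.
Qed.

Lemma computable_left_overz k1 k2 f g h i :
  computable f -> computable g -> computable h -> computable i ->
  computable (fun z m v => left_overz k1 k2 z (f z m v) (g z m v) (h z m v) (i z m v)).
Proof.
apply: (computable_call4 (F := fun z _ => left_overz k1 k2 z)).
apply: (computable_all (b := fun z m v => (nth 0 v 3 <= nth 0 v 0) ==>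
  excessz k1 k2 z (nth 0 v 1) (nth 0 v 2) (nth 0 v 0) (nth 0 v 4))).
apply: computable_imply; first by apply: computable_leq; exact: computable_arg.
by apply: computable_excessz; exact: computable_arg.
Qed.

Lemma computable_succ f : computable f -> computable (fun z m v => (f z m v).+1).
Proof.
by move=> hf; apply: computable_ext (computable_add hf (computable_num 1)) => z m v; rewrite addn1.
Qed.

Lemma computable_matchedz f g h i j :
  computable f -> computable g -> computable h -> computable i -> computable j ->
  computable (fun z m v => matchedz z (f z m v) (g z m v) (h z m v) (i z m v) (j z m v)).
Proof.
move=> hf hg hh hi hj; have hs := computable_succ hh; apply: computable_and.
  exact: computable_ltn hs computable_bound.
apply: computable_and; first exact: computable_excessz.
apply: computable_and; first exact: computable_eqmz.
by apply: computable_and; exact: computable_left_overz.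
Qed.

Lemma computable_partnerz f g h : computable f -> computable g -> computable h ->
  computable (fun z m v => partnerz z (f z m v) (g z m v) (h z m v)).
Proof.
apply: (computable_call3 (F := fun z _ => partnerz z)).
apply: (computable_sum (f := fun z m v => if has (fun e =>
  matchedz z (nth 0 v 1) (nth 0 v 2) e (nth 0 v 0) (nth 0 v 3)) (iota 0 z) then nth 0 v 0 else 0)).
apply: computable_if (computable_arg 0) (computable_num 0).
apply: (computable_has (b := fun z m v => 
  matchedz z (nth 0 v 2) (nth 0 v 3) (nth 0 v 0) (nth 0 v 1) (nth 0 v 4))).
by apply: computable_matchedz; exact: computable_arg.
Qed.

Lemma computable_weightz f g : computable f -> computable g ->
  computable (fun z m v => weightz z m (f z m v) (g z m v)).
Proof.
apply: (computable_call2 (F := weightz)).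
apply: (computable_sum (f := fun z m v => 
  if eqmz z (nth 0 v 1) (nth 0 v 0) (nth 0 v 2) then m (nth 0 v 0) else 0)).
apply: computable_if (computable_cell (computable_arg 0)) (computable_num 0).
by apply: computable_eqmz; exact: computable_arg.
Qed.

Lemma computable_taskz : computable (fun z m v => taskz z m (nth 0 v 0)).
Proof.
have h0 := computable_arg 0; have h1 := computable_arg 1; have h2 := computable_arg 2.
have ha := computable_weightz (computable_succ h2) h0.
have hc := computable_add h0 (computable_powz h2).
have hb := computable_weightz (computable_succ h2) hc.
have hp := computable_partnerz ha hb h1.
apply: (computable_iterate (computable_num 0) h0 (computable_if (computable_ltn h1 ha) h0 hc)
  (computable_if (computable_ltn h1 ha) h1 (computable_if (computable_ltn h1 hb) h1 hp))).
Qed.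

(** * Agreement of the bounded functions with the original ones *)

Lemma modzE z x y : x < z.+1 * y -> modz z x y = x %% y.
Proof.
move=> hx; rewrite /modz /iterate; set g := fun _ _ => _.
(* Each subtraction lowers the bound on the current value by [y]; after z rounds it is below [y]. *)
have E i : i <= z -> (iteri i g (x, 0)).1 = x %[mod y] /\ (iteri i g (x, 0)).1 < (z.+1 - i) * y.
  elim: i => [|i IH] hi; first by rewrite subn0.
  have [e1 e2] := IH (ltnW hi); rewrite iteriS; move: (iteri i g (x, 0)) e1 e2 => [a a'] /= e1 e2.
  case: (leqP y a) => ya.
    split; first by rewrite -e1 -[in RHS](subnK ya) modnDr.
    by move: e2; rewrite (_ : z.+1 - i = (z.+1 - i.+1).+1) ?mulSn; lia.
  split=> //; apply: leq_trans ya _; rewrite -{1}[y]mul1n leq_mul2r; lia.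
have [] := E z (leqnn z); rewrite subSnn mul1n => e1 e2.
by rewrite -e1 modn_small.
Qed.

Lemma powzE z e : e <= z -> powz z e = 2 ^ e.
Proof.
move=> he; rewrite /powz /iterate; set g := fun _ _ => _.
have E i : (iteri i g (1, 0)).1 = 2 ^ minn i e.
  elim: i => [|i IH]; first by rewrite min0n.
  rewrite iteriS; move: (iteri i g (1, 0)) IH => [a a'] /= ->; case: (ltnP i e) => h.
    by rewrite (minn_idPl h) ?(minn_idPl (ltnW h)) addnn -mul2n expnS.
  by rewrite ?(minn_idPr h) (minn_idPr (leqW h)).
by rewrite E (minn_idPr he).
Qed.

Lemma ltn_mul_exp2 z e x : x <= z -> x < z.+1 * 2 ^ e.
Proof. by move=> h; apply: leq_trans (leq_pmulr _ _); rewrite ?expn_gt0. Qed.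

(** The range goes beyond z because nodes at depth e are numbered up to 2^e, and z subtractions
    still suffice for them. *)
Lemma eqmzE z e x y : e <= z -> x < z.+1 * 2 ^ e -> y < z.+1 * 2 ^ e ->
  eqmz z e x y = eqm e x y.
Proof. by move=> he hx hy; rewrite /eqmz powzE // !modzE. Qed.

Lemma cntzE z e c x : e <= z -> c <= z -> x <= z -> cntz z e c x = cnt e c x.
Proof.
move=> he hc hx; rewrite /cnt (big_ord_widen z (fun y => eqm e y c : nat) hx).
rewrite big_mkcond; apply: eq_bigr => y _; rewrite eqmzE // ?ltn_mul_exp2 //; last exact: ltnW.
by case: ifP.
Qed.

Lemma excesszE k1 k2 z a b e c : e <= z -> c <= z -> a + b <= z ->
  excessz k1 k2 z a b e c = (excess a b e c == k2%:Z - k1%:Z)%R.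
Proof. by move=> he hc hab; rewrite /excessz !cntzE // /excess; lia. Qed.

Lemma left_overzE k1 k2 z a b e p : p <= z -> a + b <= z -> 0 < z ->
  left_overz k1 k2 z a b e p = left_over z.-1 a b (k2%:Z - k1%:Z)%R e p.
Proof.
move=> hp hab hz; rewrite /left_over prednK //; apply: eq_in_all => e'.
by rewrite mem_iota /= add0n => he; rewrite excesszE // ltnW.
Qed.

Lemma matchedzE z a b e p q : e < z -> p <= z -> q <= z -> a + b <= z ->
  matchedz z a b e p q = matched z.-1 a b 1 e p q.
Proof.
move=> he hp hq hab; have z0 : 0 < z by lia.
rewrite /matchedz /matched excesszE ?(ltnW he) // !left_overzE // eqmzE ?(ltnW he) ?ltn_mul_exp2 //.
by rewrite !GRing.subr0 GRing.sub0r (_ : (e.+1 < z) = (e < z.-1)) //; lia.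
Qed.

Lemma partnerzE z a b q : a + b <= z -> q <= z -> partnerz z a b q = partner z a b q.
Proof.
move=> hab hq; apply: eq_bigr => p _; congr (if _ then _ else _).
by apply: eq_in_has => e; rewrite mem_iota /= add0n => he; rewrite matchedzE // ltnW.
Qed.

Lemma weightzE z m i c : i <= z -> c < 2 ^ i -> weightz z m i c = weight z m i c.
Proof.
move=> hi hc; have hc' : c < z.+1 * 2 ^ i by apply: leq_trans hc (leq_pmull _ _).
by apply: eq_bigr => j _; rewrite eqmzE // ltn_mul_exp2 // ltnW.
Qed.

Lemma taskzE z m p : weight z m 0 0 <= z -> p < weight z m 0 0 ->
  taskz z m p = (descend z m z p).1.
Proof.
move=> hz hp; rewrite /taskz /iterate; set g := fun _ _ => _.
suff E l : l <= z -> iteri l g (0, p) = descend z m l p by rewrite E.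
elim: l => // l IH hl; rewrite /= IH ?(ltnW hl) //.
have /andP[h1 h2] := descend_bound hz l hp.
rewrite /g /descend_step -/(descend z m l p); move: (descend z m l p) h1 h2 => [c x] /= h1 h2.
have hab := weight_le z m l c; rewrite weight_split in hab h2.
rewrite powzE ?(ltnW hl) // !weightzE // ?expnS; try lia.
rewrite partnerzE; try lia.
by rewrite /branch; case: ltnP.
Qed.

Lemma weight_ext z m m' i c : (forall x, x < z -> m x = m' x) ->
  weight z m i c = weight z m' i c.
Proof. by move=> h; apply: eq_bigr => j _; rewrite h. Qed.

Lemma descend_ext z m m' l p : (forall x, x < z -> m x = m' x) ->
  descend z m l p = descend z m' l p.
Proof.
move=> h; elim: l => //= l IH; rewrite -/(descend z m l p) -/(descend z m' l p) IH.
by rewrite /descend_step !(weight_ext _ _ h).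
Qed.


(* The tasks are first written to the cells from [w + t] on, since the input
   cells are read until the last of them is known. *)
Lemma descend_program : exists p B, poly_bounded B /\
  forall w t m, 4 <= w + t -> weight (w + t) m 0 0 <= w + t ->
  forall s, reg s 0 = w -> reg s 1 = t -> cell s = m ->
  runs (B (w + t)) p s (fun s' => forall i, i < weight (w + t) m 0 0 ->
    cell s' i = (descend (w + t) m (w + t) i).1).
Proof.
have [p [B [hB hp]]] := @computable_taskz [:: 3] 6 isT isT.
(* Register 2 holds the bound, 3 the worker, 4 and 5 serve the loop, 6 receives the task and 7 is
   scratch. *)
pose step1 := ISeq p (ISeq (IAdd 7 2 3) (ISeq (IWrite 7 6) (ISeq (IConst 7 1) (IAdd 3 3 7)))).
pose step2 := ISeq (IAdd 7 2 3) (ISeq (IRead 6 7) (ISeq (IWrite 3 6)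
  (ISeq (IConst 7 1) (IAdd 3 3 7)))).
exists (ISeq (IAdd 2 0 1) (ISeq (IConst 3 0) (ISeq (loop 4 step1)
  (ISeq (IConst 3 0) (loop 4 step2))))).
exists (fun z => 1 + (1 + ((3 + z * ((B z + (1 + (1 + (1 + 1)))) + 3)) +
  (1 + (3 + z * ((1 + (1 + (1 + (1 + 1)))) + 3)))))); split.
  by repeat first [exact: pb_const | exact: pb_id | apply: pb_add => // | apply: pb_mul => // ].
move=> w t m h4 hW s hw ht hm.
apply: runs_seq; apply: runs_add; apply: runs_seq; apply: runs_const.
set s1 := set_reg _ _ _; set z := w + t in h4 hW *.
have z1 : reg s1 2 = z by rewrite /= /upd /= hw ht.
pose T i := (descend z m z i).1; set W := weight z m 0 0 in hW *.
apply: runs_seq; rewrite -[X in runs (3 + X * _)]z1.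
(* The loop makes z rounds, and only the values for j < W are meaningful. Cells from z on may be
   overwritten, since the descent reads only those below z. *)
pose Inv1 i s := [/\ reg s 2 = z, reg s 3 = i, forall x, x < z -> cell s x = m x &
  forall j, j < i -> j < W -> cell s (z + j) = T j].
apply: (runs_loop (Inv := Inv1)) => //.
- move=> i u u' hr hc [i1 i2 i3 i4]; split; rewrite ?hr ?hc //.
- rewrite z1 => i u hi [i1 i2 i3 i4]; rewrite -i1 in h4 *.
  apply: runs_seq; apply: runs_weaken (hp _ h4) (leqnn _) _ => u1 [j1 j2 j3].
  apply: runs_seq; apply: runs_add; apply: runs_seq; apply: runs_write.
  apply: runs_seq; apply: runs_const; apply: runs_add.
  split; last by rewrite /= /upd /= j2.
  have iw : i < W -> reg u1 6 = T i.
    move=> iW; rewrite j1 /= i1 i2.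
    have hx x : x < z -> cell u x = m x by exact: i3.
    rewrite taskzE; first by rewrite (descend_ext _ _ hx).
      by rewrite (weight_ext _ _ hx).
    by rewrite (weight_ext _ _ hx).
  split; rewrite /= /upd /= ?(j2 2) ?(j2 3) // ?i1 ?i2 ?addn1 //.
    by move=> x hx; rewrite j3 i3 // (_ : (x == z + i) = false) //; lia.
  move=> j hj jW; rewrite eqn_add2l j3; case: eqP => [e|ne]; first by rewrite e iw // -e.
  by apply: i4; lia.
- split=> //=; rewrite ?z1 //; by rewrite hm.
move=> u; rewrite z1 => -[i1 i2 i3 i4].
apply: runs_seq; apply: runs_const; set u1 := set_reg _ _ _.
have zu : reg u1 2 = z by rewrite /= /upd /= i1.
rewrite -[X in runs (3 + X * _)]zu.
pose Inv2 i s := [/\ reg s 2 = z, reg s 3 = i, forall j, j < i -> j < W -> cell s j = T j &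
  forall j, j < W -> cell s (z + j) = T j].
apply: (runs_loop (Inv := Inv2)) => //.
- move=> i v v' hr hc [j1 j2 j3 j4]; split; rewrite ?hr ?hc //.
- rewrite zu => i v hi [j1 j2 j3 j4].
  apply: runs_seq; apply: runs_add; apply: runs_seq; apply: runs_read.
  apply: runs_seq; apply: runs_write.
  apply: runs_seq; apply: runs_const; apply: runs_add.
  split; last by [].
  split; rewrite /= /upd /= ?j1 ?j2 ?addn1 //.
    move=> j hj jW; case: eqP => [e|ne]; first by rewrite -e; apply: j4.
    by apply: j3; lia.
  move=> j jW; case: eqP => [e|_]; [lia | exact: j4].
- split=> //=; rewrite ?z1 // => j jW; apply: i4; lia.
move=> v; rewrite zu => -[j1 j2 j3 j4] i iW; apply: j3 => //; lia.
Qed.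

(** * Every task receives its number of workers *)

Lemma weight_top z m c : c < z -> weight z m z c = m c.
Proof.
move=> hc; have h2 x : x < z -> x < 2 ^ z by move=> h; apply: (ltn_trans h); exact: ltn_expl.
rewrite /weight (bigD1 (Ordinal hc)) //= eqm_refl big1 ?addn0 // => j /eqP hj.
rewrite eqm_small ?h2 //; case: eqP => // e; case: hj; exact: val_inj.
Qed.

(** At depth z different tasks lie below different nodes, as z < 2^z; a node that is not a task has
    weight 0 and cannot hold a worker. *)
Lemma descend_task z m p : weight z m 0 0 <= z -> p < weight z m 0 0 ->
  ((descend z m z p).1 < z) && ((descend z m z p).2 < m (descend z m z p).1).
Proof.
move=> hz hp; have /andP[h1 h2] := descend_bound hz z hp.
have hc : (descend z m z p).1 < z.
  rewrite ltnNge; apply/negP => hc; move: h2; rewrite /weight big1 // => j _.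
  rewrite eqm_small ?(ltn_trans (ltn_ord j) (ltn_expl _ _)) //.
  by rewrite ltn_eqF // (leq_trans (ltn_ord j)).
by rewrite hc; move: h2; rewrite weight_top.
Qed.

Lemma weight0 z m : weight z m 0 0 = \sum_(j < z) m j.
Proof. by apply: eq_bigr => j _; rewrite /eqm !modn1. Qed.

(** The workers of a task are numbered injectively below its multiplicity, which gives an inequality
    for every task. Both sides sum to w, so all of them are equalities. *)
Lemma card_descend z m w j : weight z m 0 0 <= z -> weight z m 0 0 = w -> j < z ->
  #|[set i : 'I_w | (descend z m z i).1 == j]| = m j.
Proof.
move=> hz hw hj.
have le c : c < z -> #|[set i : 'I_w | (descend z m z i).1 == c]| <= m c.
  move=> hc; rewrite -[m c]card_ord.
  have hlt (i : 'I_w) : i < weight z m 0 0 by rewrite hw.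
  have hm (i : 'I_w) : (descend z m z i).1 == c -> (descend z m z i).2 < m c.
    by move=> /eqP e; have /andP[_] := descend_task hz (hlt i); rewrite e.
  have [->|[i0]] := set_0Vmem [set i : 'I_w | (descend z m z i).1 == c]; first by rewrite cards0.
  rewrite inE => /hm h0.
  (* The worker [i0] provides the inhabitant that [insubd] asks for; on the workers of task [c] the
     default is never taken. *)
  pose f (i : 'I_w) : 'I_(m c) := insubd (Ordinal h0) (descend z m z i).2.
  apply: (@leq_card_in _ _ f) => // i i'; rewrite !inE => hi hi' /(congr1 val).
  rewrite !val_insubd !hm // => e; apply: val_inj.
  apply: (descend_inj hz (l := z) (hlt i) (hlt i')).
  by rewrite [LHS]surjective_pairing [RHS]surjective_pairing (eqP hi) (eqP hi') e.
have e : \sum_(c < z) #|[set i : 'I_w | (descend z m z i).1 == c]| = \sum_(c < z) m c.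
  rewrite -weight0 hw -[RHS]card_ord -sum1_card.
  have hlt (i : 'I_w) : (descend z m z i).1 < z.
    by have /(descend_task hz)/andP[] : i < weight z m 0 0 by rewrite hw.
  rewrite (partition_big (fun i => Ordinal (hlt i)) xpredT) //.
  by apply: eq_bigr => c _; rewrite -sum1_card; apply: eq_bigl => i; rewrite !inE.
have := leqif_sum (fun (c : 'I_z) (_ : xpredT c) => conj (le c (ltn_ord c)) (erefl _)).
by case=> _; rewrite e eqxx => /esym/forallP/(_ (Ordinal hj))/eqP.
Qed.

(** * The switching cost *)

Section Assignment.
Variables w t : nat.
Implicit Types T : task_multiset w t.

Definition multiplicity T (a : nat) : nat :=
  if insub a is Some j then tasks T j else 0.

Lemma multiplicity_ord T (j : 'I_t) : multiplicity T j = tasks T j.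
Proof. by rewrite /multiplicity valK. Qed.

Lemma multiplicity_out T x : t <= x -> multiplicity T x = 0.
Proof. by move=> h; rewrite /multiplicity insubF // ltnNge h. Qed.

Lemma size_mset_ord (A : {mset 'I_t}%mset) : size A = \sum_(j < t) A j.
Proof.
rewrite size_mset big_uniq ?fset_uniq //= [RHS](bigID (mem (finsupp A))) /=.
by rewrite [X in _ = _ + X]big1 ?addn0 // => j; rewrite mem_finsupp negbK => /eqP.
Qed.

Lemma weight_widen z m : t <= z -> (forall x, t <= x -> m x = 0) ->
  weight z m 0 0 = \sum_(j < t) m j.
Proof.
move=> hz hm; rewrite weight0 -(subnKC hz) big_split_ord /= [X in _ + X]big1 ?addn0 //.
by move=> j _; rewrite hm ?leq_addr.
Qed.

Lemma weight_multiplicity T : weight (w + t) (multiplicity T) 0 0 = w.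
Proof.
rewrite weight_widen ?leq_addl //; last exact: multiplicity_out.
rewrite -[RHS](eqP (tasks_size T)) size_mset_ord.
by apply: eq_bigr => j _; rewrite multiplicity_ord.
Qed.

Lemma weight_multiplicity_le T : weight (w + t) (multiplicity T) 0 0 <= w + t.
Proof. by rewrite weight_multiplicity leq_addr. Qed.

Definition task_index T (i : nat) : nat := (descend (w + t) (multiplicity T) (w + t) i).1.

Lemma task_index_lt T (i : 'I_w) : task_index T i < t.
Proof.
have hi : i < weight (w + t) (multiplicity T) 0 0 by rewrite weight_multiplicity.
have /andP[_] := descend_task (weight_multiplicity_le T) hi.
by rewrite ltnNge; apply: contraNT; rewrite -leqNgt => /(multiplicity_out T)->.
Qed.

Definition worker_task T (i : 'I_w) : 'I_t := Ordinal (task_index_lt T i).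

Lemma worker_task_card T j : #|[set i | worker_task T i == j]| = tasks T j.
Proof.
have hj : j < w + t by rewrite (leq_trans (ltn_ord j)) ?leq_addl.
rewrite -multiplicity_ord.
by rewrite -(card_descend (weight_multiplicity_le T) (weight_multiplicity T) hj).
Qed.

Definition tree_assignment : assignment w t := Assignment worker_task_card.

(** Adjacent multisets are thus compared through their intersection, from which each arises by one
    insertion. *)
Lemma msetB_size1 T1 T2 : size (T1 `\` T2)%mset == 1 ->
  exists j : 'I_t, forall x : nat,
    multiplicity T1 x = minn (multiplicity T1 x) (multiplicity T2 x) + (x == j).
Proof.
rewrite size_mset_ord => /sum_nat_eq1[j [_ hj h]].
exists j => x; have [hx|hx] := ltnP x t; last first.
  by rewrite !multiplicity_out // gtn_eqF // (leq_trans (ltn_ord j)).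
rewrite (_ : x = Ordinal hx) // !multiplicity_ord.
have := h (Ordinal hx); rewrite msetE2 -val_eqE /= => h'.
have [e|ne] := eqVneq x j.
  rewrite (_ : Ordinal hx = j); last exact: val_inj.
  by move: hj; rewrite msetE2; move: (tasks T1 j) (tasks T2 j) => a b; lia.
by have := h' ne isT; move: (tasks T1 _) (tasks T2 _) => a b; lia.
Qed.

(** The descent for the intersection, which has w - 1 tasks, lies one insertion away from both
    assignments; the two costs add up. *)
Lemma tree_assignment_stable k T1 T2 : w < 2 ^ k -> t <= 2 ^ k -> adjacent T1 T2 ->
  pair_switching_cost tree_assignment T1 T2 <= (k * (k * 2).+1) * 2 + 1.
Proof.
move=> hw ht /andP[/msetB_size1[j1 h1] /msetB_size1[j2 h2]].
pose m x := minn (multiplicity T1 x) (multiplicity T2 x).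
have {}h2 x : multiplicity T2 x = m x + (x == j2) by rewrite /m minnC.
have w1 : weight (w + t) m 0 0 + 1 = w.
  rewrite -[RHS](weight_multiplicity T1) !weight_widen ?leq_addl //.
  - rewrite (eq_bigr (fun i : 'I_t => m i + (i == j1 :> nat)) (fun i _ => h1 i)).
    rewrite big_split /=; congr (_ + _).
    by rewrite (bigD1 j1) //= eqxx big1 // => i; rewrite -val_eqE => /negbTE->.
  - by move=> x /(multiplicity_out T1).
  - by move=> x /(multiplicity_out T1) e; rewrite /m e min0n.
have out x : 2 ^ k <= x -> m x = 0.
  by move=> /(leq_trans ht)/(multiplicity_out T1) e; rewrite /m e min0n.
have hj (j : 'I_t) : j < w + t /\ j < 2 ^ k by have := ltn_ord j; lia.
have S T (j : 'I_t) : (forall x, multiplicity T x = m x + (x == j)) ->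
    exists2 s : seq nat, size s <= k * (k * 2).+1 &
      forall p, p.+1 < w -> (descend (w + t) m (w + t) p).1 != task_index T p -> p \in s.
  move=> hT; have [hj1 hj2] := hj j.
  have [|||s hs h] :=
    @descend_stable (w + t) m _ (multiplicity T) j k k (w + t) hT _ hj1 _ hj2 out; try lia.
  exists s; first by apply: leq_trans hs _; rewrite leq_mul2r geq_minr orbT.
  by move=> p hp hd; apply: h; [lia | apply: contra hd => /eqP->].
have [s1 hs1 e1] := S _ _ h1; have [s2 hs2 e2] := S _ _ h2.
rewrite /pair_switching_cost cardE -(size_map val).
(* The intersection provides no task for worker w - 1, who is counted as changed. *)
apply: (@leq_trans (size (w.-1 :: s1 ++ s2))); last by rewrite /= size_cat; lia.
apply: uniq_leq_size; first by rewrite map_inj_uniq ?enum_uniq //; exact: val_inj.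
move=> _ /mapP[i + ->]; rewrite mem_enum inE -val_eqE /= => hd.
rewrite inE mem_cat; have [->|ne] := eqVneq (i : nat) w.-1; first by [].
have hi : i.+1 < w by have := ltn_ord i; lia.
have [e|/(e1 _ hi)->//] := eqVneq (descend (w + t) m (w + t) i).1 (task_index T1 i).
by rewrite e2 ?orbT // e.
Qed.

End Assignment.

Lemma tree_assignment_switching_cost w t k : w < 2 ^ k -> t <= 2 ^ k ->
  switching_cost (tree_assignment w t) <= (k * (k * 2).+1) * 2 + 1.
Proof.
move=> hw ht; apply/bigmax_leqP => T1 _; apply/bigmax_leqP => T2.
exact: tree_assignment_stable.
Qed.

Lemma tree_assignment_explicit : explicit_family tree_assignment.
Proof.
have [p [B [[d hd] hp]]] := descend_program.
exists p, d => w t hw ht T; have h4 : 4 <= w + t by lia.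
have [n [s [h1 h2 h3]]] := hp w t _ h4 (weight_multiplicity_le T) (input_state T)
  (erefl _) (erefl _) (erefl _).
exists n, s; split=> //; first exact: leq_trans h2 (hd _ h4).
by move=> i; rewrite h3 // weight_multiplicity.
Qed.

Import Order.TTheory GRing.Theory Num.Theory.

(** * Binary and natural logarithms *)

Section RealBound.
Variable R : realType.
Local Open Scope ring_scope.

(** From exp(-1/2) >= 1 - 1/2 it follows that exp(1/2) <= 2. *)
Lemma ln2_ge : 2^-1 <= ln 2 :> R.
Proof.
rewrite -[leLHS]expRK ler_ln ?posrE ?expR_gt0 //.
have h := expR_ge1Dx (- 2^-1 : R).
have e : sequences.expR (2^-1) * sequences.expR (- 2^-1) = 1 :> R by rewrite -expRD subrr expR0.
have := expR_gt0 (2^-1 : R); move: h e; move: (sequences.expR _) (sequences.expR _) => x y; nra.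
Qed.

Lemma trunc_log_le_ln n : (0 < n)%N -> (trunc_log 2 n)%:R <= 2 * ln (n%:R : R).
Proof.
move=> n0; have : (2 ^ trunc_log 2 n <= n)%N by exact: trunc_logP.
rewrite -(ler_nat R) natrX => h.
have : ln (2 ^+ trunc_log 2 n : R) <= ln n%:R by rewrite ler_ln ?posrE ?exprn_gt0 ?ltr0n.
rewrite lnXn ?ltr0n // -[ln 2 *+ _]mulr_natr.
have h0 : 0 <= (trunc_log 2 n)%:R :> R by exact: ler0n.
have := ln2_ge; nra.
Qed.
End RealBound.

Theorem theorem2 (R : realType) :
  exists C : R, (0 < C)%R /\
    exists phi : forall w t : nat, assignment w t,
      explicit_family phi /\
      forall w t : nat, 2 <= w -> 2 <= t ->
        ((switching_cost (phi w t))%:R <= C * (ln ((w * t)%N%:R : R)) `^ C)%R.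
Proof.
(* With k = l + 1 the cost is at most 4k^2 + 2k + 1 <= 7k^2. For y = ln(wt) >= 1, k <= 2y + 1 <= 3y
   gives 63 y^2, and y^2 <= y^63. *)
exists 63%:R%R; split; first by rewrite ltr0n.
exists tree_assignment; split; first exact: tree_assignment_explicit.
move=> w t hw ht; set n := w * t; set l := trunc_log 2 n.
have n4 : 4 <= n by rewrite /n -[4]/(2 * 2) leq_mul.
have l2 : 2 <= l by rewrite trunc_log_max.
have nl : n < 2 ^ l.+1 by apply: trunc_log_ltn.
have hcost := @tree_assignment_switching_cost w t l.+1.
have {}hcost : switching_cost (tree_assignment w t) <= 7 * l.+1 ^ 2.
  by apply: leq_trans (hcost _ _) _; nia.
have hl : (l%:R <= 2 * ln (n%:R : R))%R by apply: trunc_log_le_ln; lia.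
have l2R : (2 <= l%:R :> R)%R by rewrite ler_nat.
set y := ln _ in hl *.
have y1 : (1 <= y)%R by lra.
apply: (@le_trans _ _ (7 * (l.+1%:R) ^+ 2)%R).
  by rewrite -natrX -natrM ler_nat.
apply: (@le_trans _ _ (63 * y ^+ 2)%R).
  by rewrite -natr1; nra.
rewrite ler_wpM2l // -powR_mulrn; last lra.
by rewrite ler_powR // ler_nat.
Qed.
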